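(* Let $\beta=2$ and $n\ge2$. The principal terms $\hat{\mathcal I}_{2,n}$ satisfy $$\hat{\mathcal I}_{2,n}(X_n;Y_n)=\prod_{i=1}^{n-1}(x_i-x_n)(y_i-y_n)^2\;\prod_{i=1}^{n-1}\Big(x_i-x_n-\sum_{k=1,\,k\ne i}^{n}\frac{2}{y_i-y_k}+\frac{\partial}{\partial a_i}\Big)\,\hat{\mathcal I}_{2,n-1}(X_{n-1};a)\,\Big|_{a_i=y_i,\ 1\le i\le n-1},$$ (where $\partial/\partial a_i$ acts only on $\hat{\mathcal I}_{2,n-1}(X_{n-1};a)$), and equivalently $$\hat{\mathcal I}_{2,n}(X_n;Y_n)=\Delta(X_n)^2\Delta(Y_n)^2\;\frac{\det\Big[X_{n-1}-x_n-\frac{2}{Y_{n-1}-y_n}+B+\partial_Y\Big]}{\det(X_{n-1}-x_n)}\;\frac{\hat{\mathcal I}_{2,n-1}(X_{n-1};Y_{n-1})}{\Delta(X_{n-1})^2\Delta(Y_{n-1})^2},$$ where $B$ is the $(n-1)\times(n-1)$ antisymmetric matrix with $B_{i,j}=\frac{\sqrt2}{y_i-y_j}$ for $i\ne j$, $B_{i,i}=0$, and $\partial_Y=\mathrm{diag}(\partial_{y_1},\dots,\partial_{y_{n-1}})$.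
   Context: $X_m=\mathrm{diag}(x_1,\dots,x_m)$, $Y_m=\mathrm{diag}(y_1,\dots,y_m)$, $a=\mathrm{diag}(a_1,\dots,a_{n-1})$, $\Lambda=\mathrm{diag}(\lambda_1,\dots,\lambda_{n-1})$, $\Delta(Y)=\prod_{i>j}(y_i-y_j)$; scalars inside matrix expressions are multiplied by the identity. The determinant of the matrix with operator entries is defined by the usual expansion over permutations, as a differential operator acting on everything to its right (in each term of the expansion the factors commute, so there is no ordering ambiguity). The principal term for $\beta=2$ is defined by $\hat{\mathcal I}_{2,1}=1$ and, for $n\ge2$, $$\hat{\mathcal I}_{2,n}(X_n;Y_n)=\Delta(Y_n)^{4}\prod_{i=1}^{n-1}(x_i-x_n)\;\mathop{\mathrm{Res}}_{\lambda_1\to y_1}\cdots\mathop{\mathrm{Res}}_{\lambda_{n-1}\to y_{n-1}}\;\prod_{i=1}^{n-1}\frac{d\lambda_i}{(\lambda_i-y_i)^{2}}\;\frac{\hat{\mathcal I}_{2,n-1}(X_{n-1};\Lambda)\,e^{\sum_{i=1}^{n-1}(x_i-x_n)(\lambda_i-y_i)}}{\prod_{k=1}^n\prod_{1\le i\le n-1,\,i\ne k}(y_k-\lambda_i)^{2}} .$$ *)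

(* Defs.v *)
From mathcomp Require Import all_boot all_order all_fingroup all_algebra.
From mathcomp Require Import all_classical all_reals all_analysis.
From mathcomp Require Export complex.

Set Implicit Arguments.
Unset Strict Implicit.
Unset Printing Implicit Defensive.

Import Order.TTheory GRing.Theory Num.Theory.
Import numFieldNormedType.Exports.

Local Open Scope classical_set_scope.
Local Open Scope ring_scope.

(* The definitions are written over a numClosedFieldType K with its norm
   topology; they are meant for K := R[i], the complex numbers, where R is a
   realType. *)

Section Residues.
Variable K : numClosedFieldType.
Implicit Types (f : K -> K) (y r : K).

(* The complex exponential, as the sum of its power series. *)
Definition cexp (z : K) : K := limn (series (fun k => z ^+ k / k`!%:R)).

(* f is, on a punctured neighbourhood of y, the sum of the Laurent series
   \sum_(k >= - N.+1) a k * (z - y) ^ k, and r is its coefficient a (-1).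
   The order N.+1 only bounds the order of the pole from above, since a may
   vanish, so f may also be regular at y. *)
Definition is_residue f y r : Prop :=
  exists (N : nat) (a : int -> K),
    (\forall z \near y^',
       series (fun j : nat => let k : int := j%:Z - N.+1%:Z in
                              a k * (z - y) ^ k) @ \oo --> f z)
    /\ r = a (-1).

Definition residue f y : K := xget 0 [set r | is_residue f y r].

End Residues.

Section Operators.
Variables (K : numClosedFieldType) (m : nat).

(* Operators on functions of m complex variables. *)
Definition oper : Type := ('rV[K]_m -> K) -> 'rV[K]_m -> K.

(* T_0 \o ... \o T_(m-1): the operator of largest index acts first. *)
Definition op_prod (T : 'I_m -> oper) : oper := \big[comp/id]_(i < m) T i.

Definition partial (i : 'I_m) : oper := fun f a => 'D_(delta_mx 0 i) f a.

Definition set_coord (i : 'I_m) (z : K) (L : 'rV[K]_m) : 'rV[K]_m :=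
  \row_j (if j == i then z else L 0 j).

(* The residue at z = y in the i-th variable, the others being fixed. *)
Definition res_op (i : 'I_m) (y : K) : oper :=
  fun F L => residue (fun z => F (set_coord i z L)) y.

(* Res_(L_0 -> y_0) ... Res_(L_(m-1) -> y_(m-1)) F(L).  Every coordinate of
   the point of evaluation is overwritten, so that the choice of that point
   is immaterial. *)
Definition iter_residue (F : 'rV[K]_m -> K) (y : 'rV[K]_m) : K :=
  op_prod (fun i => res_op i (y 0 i)) F y.

(* Determinant of a matrix with operator entries, by expansion over the
   permutations. *)
Definition op_det (M : 'I_m -> 'I_m -> oper) : oper :=
  fun f Y => \sum_(s : 'S_m) (-1) ^+ s * op_prod (fun i => M i (s i)) f Y.

End Operators.

Section PrincipalTerm.
Variable K : numClosedFieldType.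

Definition vdm (n : nat) (y : 'rV[K]_n) : K :=
  \prod_(i < n) \prod_(j < n | (j < i)%N) (y 0 i - y 0 j).

(* X_(m+1) |-> X_m; the dropped last entry is x 0 ord_max. *)
Definition front (m : nat) (x : 'rV[K]_m.+1) : 'rV[K]_m :=
  \row_i x 0 (widen_ord (leqnSn m) i).

(* The principal term for beta = 2; the value at n = 0 is a convention and
   plays no role. *)
Fixpoint principal (n : nat) : 'rV[K]_n -> 'rV[K]_n -> K :=
  match n with
  | 0 => fun _ _ => 1
  | m.+1 => fun x y =>
      if m == 0%N then 1 else
      let x' := front x in
      let y' := front y in
      let xn := x 0 ord_max in
      vdm y ^+ 4 * (\prod_(i < m) (x' 0 i - xn)) *
      iter_residue (fun L : 'rV[K]_m =>
        (\prod_(i < m) ((L 0 i - y' 0 i) ^+ 2)^-1) *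
        (principal x' L * cexp (\sum_(i < m) (x' 0 i - xn) * (L 0 i - y' 0 i))
         / \prod_(k < m.+1) \prod_(i < m | (i != k :> nat))
             (y 0 k - L 0 i) ^+ 2)) y'
  end.

Definition Bmx (m : nat) (Y : 'rV[K]_m) : 'M[K]_m :=
  \matrix_(i, j) (if i == j then 0 else sqrtC 2 / (Y 0 i - Y 0 j)).

(* The scalar part X - xn - 2 / (Y - yn) + B(Y) of the operator matrix. *)
Definition scalar_part (m : nat) (X : 'rV[K]_m) (xn yn : K) (Y : 'rV[K]_m) :
    'M[K]_m :=
  diag_mx X - xn%:M - diag_mx (\row_i (2 / (Y 0 i - yn))) + Bmx Y.

(* The entries of X - xn - 2 / (Y - yn) + B + d_Y, acting on functions of Y;
   the entries of the scalar part act by multiplication. *)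
Definition op_entry (m : nat) (X : 'rV[K]_m) (xn yn : K) (i j : 'I_m) :
    oper K m :=
  fun f Y => scalar_part X xn yn Y i j * f Y
             + (if i == j then partial i f Y else 0).

End PrincipalTerm.

(* Main.v *)
Require Import Defs.
From HB Require Import structures.
From mathcomp Require Import all_boot all_order all_fingroup all_algebra.
From mathcomp Require Import all_classical all_reals all_analysis.
From mathcomp Require Import complex.
From mathcomp Require Import zify ring.

Set Implicit Arguments.
Unset Strict Implicit.
Unset Printing Implicit Defensive.

Import Order.TTheory GRing.Theory Num.Theory.
Import numFieldNormedType.Exports.

Local Open Scope classical_set_scope.
Local Open Scope ring_scope.

(* Writing the weight of L_i as the exponential times its double poles at the
   other y_k, the integrand factors as the product of P(L) = I_(n-1)(X_(n-1); L)
   and of one-variable functions with a double pole at L_i = y_i.  Each residue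
   is the derivative of the remaining factor at y_i, and the logarithmic
   derivative of the weight is x_i - x_n - 2 sum_(k <> i) 1 / (y_i - y_k): this
   is the first formula.  It also shows by induction that I_n is a rational
   function whose only possible poles are the diagonals y_i = y_j, so that every
   residue is that of a function given by a convergent power series.

   In the second formula, conjugating by Delta(Y)^2 turns d_i into
   d_i - 2 sum_(k <> i) 1 / (y_i - y_k).  Expanding the determinant over
   permutations separates the fixed points, which give a product of these
   operators, from the derangements of the complement C, which give det B_C.
   By partial fractions det B_(C + i) = sum_(j in C) g_ij det B_(C - j) with
   g_ij = 2 / (y_i - y_j)^2, while commuting d_i through the coefficients of the
   first formula produces -g_ij.  The two recursions agree, as in Wick's
   theorem. *)

(** * Power series and residues *)

Section PowerSeries.
Variable K : numClosedFieldType.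
Implicit Types (a b d : nat -> K) (r w y l : K) (f g : K -> K).

Definition powser a w : K ^nat := series (fun k => a k * w ^+ k).

(** One parameter is both the constant and the inverse radius of convergence. With [1 <= r] the
    bound weakens as [r] grows, so several series can share one [r]. *)
Definition geobnd a r := 1 <= r /\ forall k, `|a k| <= r ^+ k.+1.

Lemma geobnd_le a r r' : geobnd a r -> r <= r' -> geobnd a r'.
Proof.
move=> [r1 ar] rr'; split; first exact: le_trans rr'.
move=> k; apply: le_trans (ar k) _.
by rewrite lerXn2r // nnegrE (le_trans ler01) // (le_trans r1).
Qed.

Lemma geobnd_shift a r : geobnd a r -> geobnd (a \o succn) (r ^+ 2).
Proof.
move=> [r1 ar]; split; first exact: exprn_ege1.
by move=> k; apply: le_trans (ar _) _; rewrite -exprM ler_weXn2l //; lia.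
Qed.

Lemma sum_half n : \sum_(0 <= k < n) (2 : K) ^- k <= 2.
Proof.
suff -> : \sum_(0 <= k < n) (2 : K) ^- k = 2 - 2 * 2 ^- n.
  by rewrite gerBl mulr_ge0 // invr_ge0 exprn_ge0.
elim: n => [|n IH]; first by rewrite big_geq // expr0 invr1 mulr1 subrr.
rewrite big_nat_recr //= IH exprS; field.
by rewrite expf_neq0 // pnatr_eq0.
Qed.

(** The terms are dominated by [r] times those of the geometric series of ratio 1/2. *)
Lemma powser_bound a r w n :
  geobnd a r -> `|w| * r *+ 2 <= 1 -> `|powser a w n| <= r * 2.
Proof.
move=> [r1 ar] wr; have r0 : 0 <= r by apply: le_trans r1.
apply: le_trans (ler_norm_sum _ _ _) _.
apply: le_trans (_ : \sum_(0 <= k < n) r * 2 ^- k <= _); last first.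
  by rewrite -mulr_sumr ler_wpM2l // sum_half.
apply: ler_sum => k _; rewrite normrM normrX.
apply: le_trans (_ : r ^+ k.+1 * `|w| ^+ k <= _).
  by rewrite ler_wpM2r // exprn_ge0.
rewrite exprS -mulrA -exprMn ler_wpM2l // -exprVn lerXn2r ?nnegrE //.
  by rewrite mulr_ge0.
by rewrite -div1r ler_pdivlMr // mulr_natr mulrC.
Qed.

(** The limit is within [1 <= r] of some partial sum, whence 3 in place of 2. *)
Lemma cvg_powser_bound a r w l :
  geobnd a r -> `|w| * r *+ 2 <= 1 -> powser a w @ \oo --> l -> `|l| <= r * 3.
Proof.
move=> ar wr /cvgrPdist_lt /(_ 1 ltr01) [N _ /(_ N (leqnn N)) /= lN].
rewrite -(subrK (powser a w N) l); apply: le_trans (ler_normD _ _) _.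
have -> : r * 3 = r + r * 2 by ring.
apply: lerD; last exact: powser_bound ar wr.
by apply: le_trans (ltW lN) _; case: ar.
Qed.

Lemma powser0 a : powser a 0 @ \oo --> a 0%N.
Proof.
rewrite -(cvg_shiftS _) /powser.
suff -> : [sequence series (fun k => a k * 0 ^+ k) n.+1]_n = (fun=> a 0%N).
  exact: cvg_cst.
apply/funext => n /=; rewrite /series /= big_nat_recl // expr0 mulr1 big1 ?addr0 //.
by move=> k _; rewrite expr0n mulr0.
Qed.

Lemma cvg_powser_shift a w l : w != 0 -> powser a w @ \oo --> l ->
  powser (a \o succn) w @ \oo --> (l - a 0%N) / w.
Proof.
move=> w0; rewrite -(cvg_shiftS _) => al.
suff -> : powser (a \o succn) w
        = (fun n => ([sequence powser a w n.+1]_n n - a 0%N) / w).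
  by apply: cvgMr_tmp; apply: cvgB => //; exact: cvg_cst.
apply/funext => n; rewrite /powser /series /= big_nat_recl //= expr0 mulr1.
rewrite addrC addKr mulr_suml; apply: eq_bigr => k _.
by rewrite exprS; field.
Qed.

(** Neighbourhoods are measured by an inverse radius [s]: several conditions are met together by
    adding up their inverse radii. *)
Lemma dnbhs_radiusP y (P : K -> Prop) : (\forall z \near y^', P z) <->
  exists2 s, 1 <= s & forall w, w != 0 -> `|w| * s <= 1 -> P (y + w).
Proof.
split=> [|[s s1 Ps]].
  move/nbhs_normP => [e /= e0 Pe].
  exists (1 + 2 / e) => [|w w0 ws]; first by rewrite lerDl divr_ge0 // ltW.
  apply: Pe => /=; last by rewrite -subr_eq0 addrC addKr.
  rewrite opprD addNKr normrN.
  apply: lt_le_trans (_ : `|w| * 2 <= e).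
    by rewrite ltr_pMr ?normr_gt0 // ltr1n.
  have e0' : e != 0 by rewrite gt_eqF.
  rewrite -(@ler_pM2r _ e^-1) ?invr_gt0 // divff // -mulrA.
  by apply: le_trans ws; rewrite ler_wpM2l // lerDr.
apply/nbhs_normP; exists s^-1 => /=; first by rewrite invr_gt0 (lt_le_trans ltr01).
have s0 : 0 < s by apply: lt_le_trans s1.
move=> z /= ws zy; rewrite -(subrK y z) addrC; apply: Ps; first by rewrite subr_eq0.
by rewrite -ler_pdivlMr // div1r distrC ltW.
Qed.

(** The terms at [w] tend to 0, hence are bounded by some [M], and [a k] has norm at most
    [M / |w| ^ k]. Summing the first [N] norms into [M] replaces a maximum. *)
Lemma cvg_powser_geobnd a w l : w != 0 -> powser a w @ \oo --> l ->
  exists r, geobnd a r.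
Proof.
move=> w0 /cvgP /cvg_series_cvg_0 /cvgrPdist_lt /(_ 1 ltr01) [N _ tN].
pose t k := `|a k * w ^+ k|.
pose M := 1 + \sum_(k < N) t k.
have tM k : t k <= M.
  have [kN|Nk] := ltnP k N.
    rewrite /M (bigD1 (Ordinal kN)) //= addrCA lerDl addr_ge0 //.
    by rewrite sumr_ge0 // => i _; rewrite normr_ge0.
  have := tN k Nk; rewrite /= sub0r normrN => /ltW /le_trans -> //.
  by rewrite lerDl sumr_ge0 // => i _; rewrite normr_ge0.
have M1 : 1 <= M by rewrite lerDl sumr_ge0 // => i _; rewrite normr_ge0.
pose q := 1 + `|w|^-1.
have q1 : 1 <= q by rewrite lerDl invr_ge0.
exists (M * q); split; first exact: mulr_ege1.
move=> k.
have -> : a k = (a k * w ^+ k) / w ^+ k by field; rewrite expf_neq0.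
rewrite normrM; apply: (@le_trans _ _ (M * q ^+ k)).
  apply: ler_pM => //; first exact: tM.
  rewrite normfV normrX -exprVn lerXn2r ?nnegrE ?invr_ge0 //.
    by rewrite addr_ge0 ?invr_ge0.
  by rewrite lerDr.
have M0 : 0 <= M by apply: le_trans M1.
have q0 : 0 <= q by apply: le_trans q1.
rewrite exprMn exprS ler_pM ?exprn_ge0 //.
  by rewrite ler_peMr // exprn_ege1.
by rewrite exprS ler_peMl // exprn_ge0.
Qed.

(** At [w = 1 / c] the shifted series sums to [- d 0 * c], of norm at most [3 r ^ 2]. If [d 0] were
    nonzero, the three summands of [c] would put [w] in the domain of the hypothesis, put it in the
    domain of the bound, and make that norm at least [4 r ^ 2]. *)
Lemma powser_coef0_eq0 d r s : geobnd d r -> 1 <= s ->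
  (forall w, w != 0 -> `|w| * s <= 1 -> powser d w @ \oo --> 0) ->
  d 0%N = 0.
Proof.
move=> dr s1 d0; have [r1 _] := dr.
have s0 : 0 < s by apply: lt_le_trans s1.
have r20 : 0 < r ^+ 2 by rewrite exprn_gt0 // (lt_le_trans ltr01).
apply/eqP; apply: contraT => dn0.
have dp : 0 < `|d 0%N| by rewrite normr_gt0.
pose c := s + r ^+ 2 * 2 + r ^+ 2 * 4 / `|d 0%N|.
have c2 : 0 < r ^+ 2 * 2 by rewrite mulr_gt0.
have c3 : 0 < r ^+ 2 * 4 / `|d 0%N| by rewrite divr_gt0 // mulr_gt0.
have c0 : 0 < c by rewrite !addr_gt0.
have cV : `|c^-1| = c^-1 by rewrite ger0_norm // invr_ge0 ltW.
have w0 : c^-1 != 0 by rewrite invr_eq0 gt_eqF.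
have ws : `|c^-1| * s <= 1.
  by rewrite cV mulrC ler_pdivrMr // mul1r /c -addrA lerDl addr_ge0 // ltW.
have := cvg_powser_shift w0 (d0 _ w0 ws).
move/(cvg_powser_bound (geobnd_shift dr)).
rewrite sub0r invrK normrM normrN (ger0_norm (ltW c0)) cV => /(_ _).
have -> : c^-1 * r ^+ 2 *+ 2 <= 1.
  rewrite -mulr_natr -mulrA mulrC ler_pdivrMr // mul1r /c.
  by rewrite addrAC lerDr addr_ge0 // ltW.
move=> /(_ isT) dc.
have : `|d 0%N| * (r ^+ 2 * 4 / `|d 0%N|) <= r ^+ 2 * 3.
  apply: le_trans dc; rewrite ler_wpM2l // /c lerDr addr_ge0 //; exact: ltW.
rewrite mulrC divfK ?gt_eqF // ler_pM2l // ler_nat => //.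
Qed.

Lemma powser_eq0 d r s : geobnd d r -> 1 <= s ->
  (forall w, w != 0 -> `|w| * s <= 1 -> powser d w @ \oo --> 0) ->
  forall k, d k = 0.
Proof.
move=> + s1 + k; elim: k d r => [|k IH] d r dr d0.
  exact: powser_coef0_eq0 dr s1 d0.
apply: (IH (d \o succn) _ (geobnd_shift dr)) => w w0 ws.
have := cvg_powser_shift w0 (d0 w w0 ws).
by rewrite (powser_coef0_eq0 dr s1 d0) subr0 mul0r.
Qed.

(** The factor 8 leaves a margin inside the disc of convergence, which makes the tail of a product
    of two series easy to bound. *)
Definition expands g y a := exists2 r, geobnd a r &
  forall w, `|w| * r *+ 8 <= 1 -> powser a w @ \oo --> g (y + w).

Lemma expands_at g y a : expands g y a -> g y = a 0%N.
Proof.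
move=> [r _ /(_ 0)]; rewrite normr0 mul0r mul0rn addr0 => /(_ ler01) h.
exact: (cvg_unique _ h (@powser0 a)).
Qed.

Lemma expands_eq g f y a s : 1 <= s ->
  (forall w, `|w| * s <= 1 -> f (y + w) = g (y + w)) ->
  expands g y a -> expands f y a.
Proof.
move=> s1 fg [r ar gr]; have [r1 _] := ar.
have r0 : 0 <= r by apply: le_trans r1.
have s0 : 0 <= s by apply: le_trans s1.
exists (r + s); first by apply: geobnd_le ar _; rewrite lerDl.
move=> w wrs; rewrite fg; first apply: gr.
  by apply: le_trans wrs; rewrite ler_pMn2r // ler_wpM2l // lerDl.
apply: le_trans wrs; apply: le_trans (_ : `|w| * (r + s) <= _).
  by rewrite ler_wpM2l // lerDr.
by rewrite -[leLHS]mulr1n ler_wpMn2l // mulr_ge0 // addr_ge0.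
Qed.

(** The second order remainder divided by [w ^ 2] is the twice shifted series, bounded by [3 r ^ 4].
    The difference quotient is thus within [3 r ^ 4 |w|] of [a 1]. *)
Lemma expands_derive g y a : expands g y a ->
  (fun h => h^-1 *: (g (y + h) - g y)) @ 0^' --> a 1%N.
Proof.
move=> ea; have gy := expands_at ea; move: ea => [r ar gr].
apply/cvgrPdist_le => e e0.
have ar4 := geobnd_shift (geobnd_shift ar).
have [r1 _] := ar; have [r41 _] := ar4.
set r4 := (r ^+ 2) ^+ 2 in ar4 r41.
have r0 : 0 < r by apply: lt_le_trans r1.
have r40 : 0 < r4 by apply: lt_le_trans r41.
apply/dnbhs_radiusP; exists (r * 8 + r4 * 2 + r4 * 3 / e).
  rewrite -addrA; apply: le_trans (_ : r * 8 <= _).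
    by rewrite mulr_ege1 // ler1n.
  by rewrite lerDl addr_ge0 // ?divr_ge0 // ?mulr_ge0 // ltW.
move=> w w0; rewrite add0r => ws.
have ws' t : t <= r * 8 + r4 * 2 + r4 * 3 / e -> `|w| * t <= 1.
  by move=> h; apply: le_trans ws; rewrite ler_wpM2l.
have p1 : 0 <= r * 8 by rewrite mulr_ge0 // ltW.
have p2 : 0 <= r4 * 2 by rewrite mulr_ge0 // ltW.
have p3 : 0 <= r4 * 3 / e by rewrite divr_ge0 // ?mulr_ge0 // ltW.
have w1 : `|w| * r *+ 8 <= 1.
  by rewrite -mulr_natr -mulrA ws' // -addrA lerDl addr_ge0.
have w2 : `|w| * r4 *+ 2 <= 1.
  by rewrite -mulr_natr -mulrA ws' // addrAC lerDr addr_ge0.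
have w3 : `|w| * (r4 * 3 / e) <= 1 by rewrite ws' // lerDr addr_ge0.
have h := cvg_powser_shift w0 (cvg_powser_shift w0 (gr _ w1)).
have {}h := cvg_powser_bound ar4 w2 h.
have -> : a 1%N - w^-1 *: (g (y + w) - g y) =
    - (((g (y + w) - a 0%N) / w - a 1%N) / w * w).
  by rewrite gy divfK // opprB [_ / w]mulrC.
rewrite normrN normrM; apply: le_trans (_ : r4 * 3 * `|w| <= _).
  by rewrite ler_wpM2r.
by move: w3; rewrite mulrA ler_pdivrMr // mul1r mulrC.
Qed.

(** Multiplied by [(z - y) ^ (M + 1)], both Laurent series become power series with the same sum on
    a punctured neighbourhood of [y], so their coefficients agree. *)
Lemma residue_unique f y r r' : is_residue f y r -> is_residue f y r' -> r = r'.
Proof.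
move=> [N [a [fa ->]]] [N' [a' [fa' ->]]].
pose M := (N + N')%N.
(* Index [j] of the padded series stands for the exponent [j - (M + 1)]; a series with a pole of
   order at most [n + 1] starts at [j = M - n]. *)
pose pad n (c : int -> K) (j : nat) : K :=
  if (j < M - n)%N then 0 else c (j%:Z - M.+1%:Z).
have padP n c g : (n <= M)%N ->
    (\forall z \near y^', series (fun j : nat => let k : int := j%:Z - n.+1%:Z in
                              c k * (z - y) ^ k) @ \oo --> g z) ->
    exists2 s, 1 <= s & forall w, w != 0 -> `|w| * s <= 1 ->
       powser (pad n c) w @ \oo --> w ^+ M.+1 * g (y + w).
  move=> nM /dnbhs_radiusP [s s1 gs]; exists s => // w w0 ws.
  have := gs w w0 ws; rewrite addrC addKr => gw.
  rewrite -(cvg_shiftn (M - n)).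
  suff -> : [sequence powser (pad n c) w (k + (M - n))%N]_k =
     (fun k => w ^+ M.+1 * series (fun j : nat => let k : int := j%:Z - n.+1%:Z in
                              c k * w ^ k) k) by apply: cvgMl_tmp.
  apply/funext => k; rewrite /powser /series /= mulr_sumr.
  rewrite (big_cat_nat (n := M - n)) ?leq_addl //= big1_seq ?add0r; last first.
    by move=> i /= /[!mem_index_iota] /andP [_ iM]; rewrite /pad iM mul0r.
  rewrite -{1}[(M - n)%N]add0n big_addn addnK; apply: eq_bigr => i _.
  rewrite /pad ltnNge leq_addl /= mulrCA; congr (c _ * _); first by lia.
  rewrite !exprnP -expfzDr //; congr (_ ^ _); lia.
have [s s1 fs] := padP _ _ _ (leq_addr _ _) fa.
have [s' s1' fs'] := padP _ _ _ (leq_addl _ _) fa'.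
have s0 : 0 < s by apply: lt_le_trans s1.
have s0' : 0 < s' by apply: lt_le_trans s1'.
have ss1 : 1 <= s + s' by apply: le_trans s1 _; rewrite lerDl ltW.
have sub w : w != 0 -> `|w| * (s + s') <= 1 ->
  powser (fun j => pad N a j - pad N' a' j) w @ \oo --> 0.
  move=> w0 ws.
  have h := fs _ w0 (le_trans (ler_wpM2l (normr_ge0 _) _) ws).
  have h' := fs' _ w0 (le_trans (ler_wpM2l (normr_ge0 _) _) ws).
  rewrite lerDl lerDr !ltW // in h h'.
  have -> : powser (fun j => pad N a j - pad N' a' j) w =
    powser (pad N a) w \- powser (pad N' a') w.
    apply/funext => n; rewrite /powser /series /= -sumrB; apply: eq_bigr => k _.
    by rewrite mulrBl.
  by rewrite -(subrr (w ^+ M.+1 * f (y + w))); apply: cvgB; [exact: h | exact: h'].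
have w0 : (s + s')^-1 != 0 by rewrite invr_eq0 gt_eqF // addr_gt0.
have ws : `|(s + s')^-1| * (s + s') <= 1.
  by rewrite normfV ger0_norm ?mulVf ?gt_eqF ?addr_ge0 ?addr_gt0 // ltW.
have [rr dr] := cvg_powser_geobnd w0 (sub _ w0 ws).
(* Index [M] is the exponent -1. *)
have := powser_eq0 dr ss1 sub M => /eqP.
rewrite subr_eq0 /pad !ltnNge !leq_subr /= => /eqP.
by have -> : M%:Z - M.+1%:Z = -1 by lia.
Qed.

Lemma residue_expands f g y a s : expands g y a -> 1 <= s ->
  (forall w, w != 0 -> `|w| * s <= 1 -> f (y + w) = g (y + w) / w ^+ 2) ->
  residue f y = a 1%N.
Proof.
move=> [r ar gr] s1 fg; have [r1 _] := ar.
have r0 : 0 <= r by apply: le_trans r1.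
have s0 : 0 <= s by apply: le_trans s1.
suff fa : is_residue f y (a 1%N).
  rewrite /residue; case: xgetP => [z _ fz|/(_ (a 1%N)) //].
  exact: residue_unique fz fa.
(* The exponents [k] start at -2, so the absolute value only turns [k + 2] into a natural number. *)
exists 1%N, (fun k : int => a `|(k + 2)%R|%N); split=> //.
apply/dnbhs_radiusP; exists (r * 8 + s) => [|w w0 ws].
  by apply: le_trans s1 _; rewrite lerDr mulr_ge0.
have ws' t : t <= r * 8 + s -> `|w| * t <= 1.
  by move=> h; apply: le_trans ws; rewrite ler_wpM2l.
have w1 : `|w| * r *+ 8 <= 1 by rewrite -mulr_natr -mulrA ws' // lerDl.
rewrite fg ?ws' ?lerDr ?mulr_ge0 // mulrC [y + w]addrC addrK [w + y]addrC.
have -> : series (fun j : nat => let k : int := j%:Z - 2 in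
                             a `|(k + 2)%R|%N * w ^ k) =
       (fun n => (w ^+ 2)^-1 * powser a w n).
  apply/funext => n; rewrite /powser /series /= mulr_sumr; apply: eq_bigr => k _.
  rewrite subrK absz_nat mulrCA; congr (_ * _).
  by rewrite expfzDr // mulrC -exprnN.
by apply: cvgMl_tmp; apply: gr.
Qed.

End PowerSeries.

(* The norm topology is attached to numClosedFieldType, not to R[i] itself, so
   the analysis is carried out over an abstract K with the two properties of
   R[i] that it needs. *)
Definition analytic_field (K : numClosedFieldType) : Prop :=
  (forall e : K, 0 <= e -> exists N : nat, e < N%:R) /\
  (forall z : K, powser (fun k => k`!%:R^-1) z @ \oo --> cexp z).

(* g is the sum of a power series around y, with linear coefficient d. *)
Definition hasder (K : numClosedFieldType) (g : K -> K) y d :=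
  exists2 a, expands g y a & a 1%N = d.

(** * Calculus of power series expansions and the exponential *)

Section Calculus.
Variable K : numClosedFieldType.
Hypothesis KA : analytic_field K.
Implicit Types (a b : nat -> K) (r w y c l m : K) (f g : K -> K).

(** The archimedean half of [analytic_field] enters here, together with [n < 2 ^ n]. *)
Lemma cvg0_le_half (u : nat -> K) (C : K) :
  0 <= C -> (forall n, `|u n| <= C * 2 ^- n) -> u @ \oo --> 0.
Proof.
move=> C0 uC; apply/cvgrPdist_lt => e e0.
have [N CN] := KA.1 (C / e) (divr_ge0 C0 (ltW e0)).
exists N => // n /= Nn; rewrite sub0r normrN; apply: le_lt_trans (uC n) _.
rewrite ltr_pdivrMr ?exprn_gt0 // mulrC -ltr_pdivrMr //; apply: lt_trans CN _.
by rewrite -natrX ltr_nat (leq_ltn_trans Nn) // ltn_expl.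
Qed.

Lemma hasder_cst c y : hasder (fun=> c) y 0.
Proof.
exists (fun k => if k is 0%N then c else 0) => //.
have c1 : 1 <= 1 + `|c| by rewrite lerDl.
have c0 : 0 <= 1 + `|c| by apply: le_trans c1.
exists (1 + `|c|); first by split=> // -[|k] /=; rewrite ?normr0 ?exprn_ge0 // expr1 lerDr.
move=> w _; rewrite -(cvg_shiftS _).
rewrite (_ : [sequence _]_n = (fun=> c)); first exact: cvg_cst.
apply/funext => n; rewrite /powser /series /= big_nat_recl //= mulr1 big1 ?addr0 //.
by move=> i _; rewrite mul0r.
Qed.

Lemma hasder_id y : hasder id y 1.
Proof.
exists (fun k => match k with 0%N => y | 1%N => 1 | _ => 0 end) => //.
have c1 : 1 <= 1 + `|y| by rewrite lerDl.
have c0 : 0 <= 1 + `|y| by apply: le_trans c1.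
exists (1 + `|y|).
  split=> // -[|[|k]] /=; rewrite ?normr0 ?exprn_ge0 //; first by rewrite expr1 lerDr.
  by rewrite normr1 exprn_ege1.
move=> w _; rewrite -(cvg_shiftn 2).
rewrite (_ : [sequence _]_n = (fun=> y + w)); first exact: cvg_cst.
apply/funext => n; rewrite /powser /series /= addn2 2?big_nat_recl //= mulr1 mul1r expr1.
by rewrite big1 ?addr0 // => i _; rewrite mul0r.
Qed.

Lemma radius_le w r r' : r <= r' -> `|w| * r' *+ 8 <= 1 -> `|w| * r *+ 8 <= 1.
Proof. by move=> rr; apply: le_trans; rewrite ler_pMn2r // ler_wpM2l. Qed.

Lemma hasderD f g y df dg :
  hasder f y df -> hasder g y dg -> hasder (fun z => f z + g z) y (df + dg).
Proof.
move=> [a [r ar ra] <-] [b [s bs sb] <-]; exists (fun k => a k + b k) => //.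
have [r1 _] := ar; have [s1 _] := bs.
have r0 : 0 <= r by apply: le_trans r1.
have s0 : 0 <= s by apply: le_trans s1.
exists (r + s).
  split; first by apply: le_trans r1 _; rewrite lerDl.
  move=> k; apply: le_trans (ler_normD _ _) _.
  apply: le_trans (lerD (ar.2 k) (bs.2 k)) _.
  elim: k => [|k IH]; first by rewrite !expr1.
  rewrite ![_ ^+ k.+2]exprS mulrDl lerD // ler_wpM2l //; apply: le_trans IH.
    by rewrite lerDl exprn_ge0.
  by rewrite lerDr exprn_ge0.
move=> w ws.
have -> : powser (fun k => a k + b k) w = powser a w \+ powser b w.
  apply/funext => n; rewrite /powser /series /= -big_split; apply: eq_bigr => k _.
  by rewrite mulrDl.
by apply: cvgD; [apply: ra | apply: sb]; apply: radius_le ws; rewrite ?lerDl ?lerDr.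
Qed.

(** Cauchy product. [D n], the product of the truncations minus the truncated Cauchy product,
    consists of the terms of degree at least [n] in a product of two polynomials. It is at most
    [r ^ 2 * n / 4 ^ n], hence at most [r ^ 2 / 2 ^ n]. *)
Lemma powserM_cvg a b r w l m : geobnd a r -> geobnd b r -> `|w| * r *+ 8 <= 1 ->
  powser a w @ \oo --> l -> powser b w @ \oo --> m ->
  powser (fun k => \sum_(i < k.+1) a i * b (k - i)%N) w @ \oo --> l * m.
Proof.
move=> ar br wr al bm; set c := fun k => _.
pose D n := powser a w n * powser b w n - powser c w n.
have -> : powser c w = (powser a w \* powser b w) \- D.
  by apply/funext => n; rewrite /= /D opprB addrC subrK.
rewrite -[l * m]subr0; apply: cvgB; first exact: cvgM.
have [r1 _] := ar; have r0 : 0 <= r by apply: le_trans r1.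
apply: (@cvg0_le_half _ (r ^+ 2)) => [|n]; first exact: exprn_ge0.
pose p := \poly_(i < n) a i; pose q := \poly_(i < n) b i.
have pE : powser a w n = p.[w].
  by rewrite horner_poly /powser /series /= big_mkord.
have qE : powser b w n = q.[w].
  by rewrite horner_poly /powser /series /= big_mkord.
have cE k : (k < n)%N -> (p * q)`_k = c k.
  move=> kn; rewrite coefM; apply: eq_bigr => i _.
  by rewrite !coef_poly (leq_trans (ltn_ord i)) // (leq_ltn_trans (leq_subr _ _)).
have cbnd k : `|(p * q)`_k| <= k.+1%:R * r ^+ k.+2.
  rewrite coefM; apply: le_trans (ler_norm_sum _ _ _) _.
  rewrite -[k.+1 in X in _ <= X * _]card_ord -sumr_const mulr_suml; apply: ler_sum => i _.
  have bnd (u : nat -> K) j : geobnd u r -> `|(\poly_(i < n) u i)`_j| <= r ^+ j.+1.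
    by move=> ur; rewrite coef_poly; case: ifP => _; [exact: ur.2 | rewrite normr0 exprn_ge0].
  have -> : r ^+ k.+2 = r ^+ i.+1 * r ^+ (k - i).+1.
    by rewrite -exprD; congr (_ ^+ _); move: (ltn_ord i); lia.
  by rewrite mul1r normrM ler_pM // bnd.
have -> : D n = \sum_(n <= k < n + n) (p * q)`_k * w ^+ k.
  rewrite /D pE qE -hornerM (@horner_coef_wide _ (n + n)).
    rewrite -(big_mkord xpredT (fun i => (p * q)`_i * w ^+ i)) (big_cat_nat (n := n)) ?leq_addr //=.
    rewrite /powser /series /= addrAC [X in X - _](_ : _ = \sum_(0 <= k < n) c k * w ^+ k).
      by rewrite subrr add0r.
    by apply: eq_big_nat => k /andP [_ kn]; rewrite cE.
  apply: leq_trans (size_polyMleq _ _) _; apply: leq_trans (leq_pred _) _.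
  by rewrite leq_add // size_poly.
apply: le_trans (ler_norm_sum _ _ _) _.
apply: (@le_trans _ _ (\sum_(n <= k < n + n) r ^+ 2 * 4 ^- n)).
  apply: ler_sum_nat => k /andP [nk _]; rewrite normrM normrX.
  (* The number [k + 1] of summands of a coefficient is at most [2 ^ k]; this power is absorbed into
     [(2 |w| r) ^ k], where [2 |w| r <= 1/4]. *)
  apply: (@le_trans _ _ (2 ^+ k * r ^+ k.+2 * `|w| ^+ k)).
    rewrite ler_wpM2r ?exprn_ge0 //; apply: le_trans (cbnd k) _.
    by rewrite ler_wpM2r ?exprn_ge0 // -natrX ler_nat ltn_expl.
  have -> : 2 ^+ k * r ^+ k.+2 * `|w| ^+ k = r ^+ 2 * (`|w| * r *+ 2) ^+ k.
    by rewrite -[(_ * _) *+ 2]mulr_natl !exprMn !exprS; ring.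
  rewrite ler_wpM2l ?exprn_ge0 //.
  apply: (@le_trans _ _ (4^-1 ^+ k)).
    rewrite lerXn2r ?nnegrE ?invr_ge0 ?mulrn_wge0 ?mulr_ge0 //.
    by rewrite -div1r ler_pdivlMr // mulr_natr -mulrnA.
  by rewrite exprVn lef_pV2 ?posrE ?exprn_gt0 // ler_weXn2l // ler1n.
rewrite sumr_const_nat addnK -[(_ * _) *+ n]mulr_natr -mulrA ler_wpM2l ?exprn_ge0 //.
have -> : 4 = 2 * 2 :> K by rewrite -natrM.
rewrite ler_pdivrMl ?exprn_gt0 ?mulr_gt0 // exprMn -mulrA mulfV ?expf_neq0 // mulr1.
by rewrite -natrX ler_nat ltnW // ltn_expl.
Qed.

Lemma hasderM f g y df dg : hasder f y df -> hasder g y dg ->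
  hasder (fun z => f z * g z) y (f y * dg + df * g y).
Proof.
move=> [a ea <-] [b eb <-].
exists (fun k => \sum_(i < k.+1) a i * b (k - i)%N); last first.
  by rewrite !big_ord_recl big_ord0 addr0 (expands_at ea) (expands_at eb).
move: ea eb => [r ar ra] [s bs sb].
have [r1 _] := ar; have [s1 _] := bs.
have r0 : 0 <= r by apply: le_trans r1.
have s0 : 0 <= s by apply: le_trans s1.
have at' : geobnd a (r + s) by apply: geobnd_le ar _; rewrite lerDl.
have bt : geobnd b (r + s) by apply: geobnd_le bs _; rewrite lerDr.
set t := r + s in at' bt; have [t1 _] := bt.
have t0 : 0 <= t by apply: le_trans t1.
(* The coefficient of order [k] is at most [(k + 1) t ^ (k + 2)], and [k + 1 <= 2 ^ (k + 1)]. *)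
exists (t ^+ 2 * 2).
  split; first by rewrite mulr_ege1 ?exprn_ege1 // ler1n.
  move=> k; apply: le_trans (ler_norm_sum _ _ _) _.
  apply: (@le_trans _ _ (\sum_(i < k.+1) t ^+ k.+2)).
    apply: ler_sum => i _; have -> : t ^+ k.+2 = t ^+ i.+1 * t ^+ (k - i).+1.
      by rewrite -exprD; congr (_ ^+ _); move: (ltn_ord i); lia.
    by rewrite normrM ler_pM // ?at'.2 ?bt.2.
  rewrite sumr_const card_ord exprMn -exprM -[(_ ^+ _) *+ _]mulr_natr ler_pM ?exprn_ge0 //.
    by rewrite ler_weXn2l //; lia.
  by rewrite -natrX ler_nat ltnW // ltn_expl.
move=> w ws.
have tt : t <= t ^+ 2 * 2.
  by rewrite expr2 -mulrA ler_peMr // mulr_ege1 // ler1n.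
have wt := radius_le tt ws.
apply: (powserM_cvg at' bt wt).
  by apply: ra; apply: radius_le wt; rewrite lerDl.
by apply: sb; apply: radius_le wt; rewrite lerDr.
Qed.

(** Geometric series of ratio [q = w / (c - y)]: the remainder after [n] terms is
    [q ^ n / (c - y - w)], and [|q| <= 1/2]. *)
Lemma hasder_inv c y : c != y -> hasder (fun z => (c - z)^-1) y ((c - y) ^- 2).
Proof.
move=> cy; have u0 : c - y != 0 by rewrite subr_eq0.
have n0 : 0 < `|c - y| by rewrite normr_gt0.
exists (fun k => (c - y) ^- k.+1) => //.
have r0 : 0 <= 1 + `|c - y|^-1 by rewrite addr_ge0 // invr_ge0.
exists (1 + `|c - y|^-1).
  split; first by rewrite lerDl invr_ge0.
  move=> k; rewrite normfV normrX -exprVn lerXn2r ?nnegrE ?invr_ge0 //.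
  by rewrite lerDr.
move=> w ws; set q := w / (c - y).
have q8 : `|q| <= 2^-1.
  rewrite /q normrM normfV -[2^-1]div1r ler_pdivlMr // mulr_natr.
  apply: le_trans ws; apply: le_trans (_ : `|w| * (1 + `|c - y|^-1) *+ 2 <= _).
    by rewrite ler_pMn2r // ler_wpM2l // lerDr.
  by rewrite ler_wpMn2l // mulr_ge0.
have q1 : 1 - q != 0.
  rewrite subr_eq0; apply/eqP => q1; move: q8; rewrite -q1 normr1.
  by rewrite -[2^-1]div1r ler_pdivlMr // mul1r (ler_nat _ 2 1).
have -> : powser (fun k => (c - y) ^- k.+1) w =
    (fun=> (c - (y + w))^-1) \- (fun n => q ^+ n / (c - y - w)).
  have cyw : c - y - w != 0.
    by have -> : c - y - w = (1 - q) * (c - y) by [rewrite /q; field]; rewrite mulf_neq0.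
  apply/funext => n /=; elim: n => [|n IH].
    rewrite /powser /series /= big_geq // expr0 opprD addrA div1r subrr //.
  rewrite /powser seriesSr /= [series _ _]IH opprD addrA /q !exprS !expr_div_n; field.
  by rewrite u0 cyw expf_neq0.
rewrite -[X in _ --> X]subr0; apply: cvgB; first exact: cvg_cst.
apply: (@cvg0_le_half _ `|(c - y - w)^-1|) => // n.
rewrite normrM mulrC ler_wpM2l // normrX -exprVn lerXn2r ?nnegrE ?invr_ge0 //.
Qed.

Lemma powser_expZ (c w : K) :
  powser (fun k => c ^+ k / k`!%:R) w = powser (fun k => k`!%:R^-1) (c * w).
Proof.
by apply/funext => n; apply: eq_bigr => k _; rewrite exprMn; ring.
Qed.

Lemma geobnd_exp (c r : K) : 1 <= r -> `|c| <= r -> geobnd (fun k => c ^+ k / k`!%:R) r.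
Proof.
move=> r1 cr; have r0 : 0 <= r by apply: le_trans r1.
split=> // k; rewrite normrM normrX normfV normr_nat.
apply: (@le_trans _ _ (r ^+ k)); last by rewrite exprS ler_peMl ?exprn_ge0.
rewrite ler_pdivrMr ?ltr0n ?fact_gt0 //; apply: (@le_trans _ _ (r ^+ k)).
  by rewrite lerXn2r ?nnegrE.
by rewrite ler_peMr ?exprn_ge0 // ler1n fact_gt0.
Qed.

Lemma hasder_cexp c y : hasder (fun z => @cexp K (c * (z - y))) y c.
Proof.
exists (fun k => c ^+ k / k`!%:R); last by rewrite expr1 divr1.
exists (1 + `|c|).
  by apply: geobnd_exp; rewrite ?lerDl ?lerDr.
move=> w _; rewrite powser_expZ [y + w]addrC addrK; exact: KA.2.
Qed.

(** Cauchy product at the fixed point 1/8: the series in [8 u] and [8 v] then satisfy [geobnd] with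
    [r = 1]. Small arguments suffice, since a residue only depends on a neighbourhood. *)
Lemma cexpD (u v : K) : `|u| *+ 8 <= 1 -> `|v| *+ 8 <= 1 ->
  cexp (u + v) = cexp u * cexp v.
Proof.
have e8 : 8^-1 * 8 = 1 :> K by rewrite mulVf.
have gb (z : K) : `|z| *+ 8 <= 1 -> geobnd (fun k => (8 * z) ^+ k / k`!%:R) 1.
  by move=> z8; apply: geobnd_exp => //; rewrite normrM normr_nat mulr_natl.
have ev (z : K) : powser (fun k => (8 * z) ^+ k / k`!%:R) 8^-1 @ \oo --> cexp z.
  rewrite powser_expZ (_ : 8 * z * 8^-1 = z); first exact: KA.2.
  by rewrite mulrC mulrA mulVf // mul1r.
move=> u8 v8.
have := powserM_cvg (gb u u8) (gb v v8) _ (ev u) (ev v).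
rewrite mulr1 normfV normr_nat -mulr_natr e8 => /(_ (lexx _)).
suff -> : (fun k => \sum_(i < k.+1) (8 * u) ^+ i / i`!%:R *
      ((8 * v) ^+ (k - i) / (k - i)`!%:R)) =
    (fun k => (8 * (u + v)) ^+ k / k`!%:R).
  by move=> h; apply: (cvg_unique _ (ev (u + v)) h).
apply/funext => k; rewrite mulrDr addrC exprDn mulr_suml; apply: eq_bigr => i _.
have ik : (i <= k)%N by rewrite -ltnS.
have nz n : n`!%:R != 0 :> K by rewrite pnatr_eq0 -lt0n fact_gt0.
rewrite -mulr_natl -(bin_fact ik) !natrM; field.
by rewrite !nz pnatr_eq0 -lt0n bin_gt0.
Qed.

Lemma cexp0 : cexp (0 : K) = 1.
Proof.
have := @powser0 K (fun k => k`!%:R^-1); rewrite fact0 invr1 => h.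
exact: (cvg_unique _ (KA.2 0) h).
Qed.

Lemma cexp_sum (I : Type) (s : seq I) (F : I -> K) :
  (\sum_(i <- s) `|F i|) *+ 8 <= 1 ->
  cexp (\sum_(i <- s) F i) = \prod_(i <- s) cexp (F i).
Proof.
elim: s => [|i s IH]; first by rewrite !big_nil cexp0.
rewrite !big_cons => h.
have h1 : `|F i| *+ 8 <= 1.
  by apply: le_trans h; rewrite ler_pMn2r // lerDl sumr_ge0.
have h2 : (\sum_(i <- s) `|F i|) *+ 8 <= 1.
  by apply: le_trans h; rewrite ler_pMn2r // lerDr.
rewrite cexpD ?IH //; apply: le_trans h2; rewrite ler_pMn2r //.
exact: ler_norm_sum.
Qed.

End Calculus.

(** * The complex numbers form an analytic field *)

Section ComplexLimits.
Variable R : realType.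
Definition complexField : numClosedFieldType := R[i].
Local Notation K := complexField.

Lemma complex_archi (e : K) : 0 <= e -> exists N : nat, e < N%:R.
Proof.
move=> e0; exists (Num.bound (complex.Re e)).
rewrite -(RRe_real (ger0_real e0)) -(rmorph_nat (real_complex R)) ltcR.
apply: archi_boundP; by move: e0; rewrite lecE => /andP [].
Qed.

Lemma normc_le_ReIm (z : K) : `|z| <= (`|complex.Re z| + `|complex.Im z|)%:C%C.
Proof.
have nR (a : R) : `|a%:C%C| = (`|a|)%:C%C by rewrite normc_def /= expr0n addr0 sqrtr_sqr.
rewrite {1}(complexE z); apply: le_trans (ler_normD _ _) _.
rewrite normrM !nR rmorphD /= lerD2l normc_def /= expr0n expr1n add0r sqrtr1 mul1r.
exact: lexx.
Qed.

Lemma cvg_complex (u : nat -> K) (a b : R) :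
  (fun n => complex.Re (u n)) @ \oo --> a -> (fun n => complex.Im (u n)) @ \oo --> b ->
  u @ \oo --> ((a +i* b)%C : K).
Proof.
move=> ua ub; apply/cvgrPdist_lt => e e0.
have eE : (complex.Re e)%:C%C = e by apply: RRe_real; apply: ger0_real; exact: ltW.
have e0' : 0 < complex.Re e / 2.
  by rewrite divr_gt0 // -ltcR eE rmorph0.
move/cvgrPdist_lt: ua => /(_ _ e0') ua; move/cvgrPdist_lt: ub => /(_ _ e0') ub.
near=> n; apply: le_lt_trans (normc_le_ReIm _) _.
rewrite -eE ltcR [complex.Re e]splitr ltrD //.
  by have -> : complex.Re ((a +i* b)%C - u n) = a - complex.Re (u n); [case: (u n) | near: n].
by have -> : complex.Im ((a +i* b)%C - u n) = b - complex.Im (u n); [case: (u n) | near: n].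
Unshelve. all: by end_near.
Qed.

Lemma Re_sum (I : Type) (s : seq I) (F : I -> K) :
  complex.Re (\sum_(i <- s) F i) = \sum_(i <- s) complex.Re (F i).
Proof. by apply: (big_morph _ _ erefl) => [[a b] [c d]]. Qed.

Lemma Im_sum (I : Type) (s : seq I) (F : I -> K) :
  complex.Im (\sum_(i <- s) F i) = \sum_(i <- s) complex.Im (F i).
Proof. by apply: (big_morph _ _ erefl) => [[a b] [c d]]. Qed.

(** The real and imaginary parts of the partial sums are real series dominated by the exponential
    series of [|z|], so the limit defining [cexp] exists. *)
Lemma cexp_cvg (z : K) : powser (fun k => k`!%:R^-1) z @ \oo --> cexp z.
Proof.
have -> : powser (fun k => k`!%:R^-1) z = series (fun k => z ^+ k / k`!%:R).
  by apply/funext => n; apply: eq_bigr => k _; rewrite mulrC.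
set u := fun k => _; pose N := complex.Re `|z|.
have NE : N%:C%C = `|z| by apply: RRe_real; exact: normr_real.
have part (p : R[i] -> R) : (forall x, `|p x|%:C%C <= `|x|) ->
    (forall (s : seq nat) (F : nat -> K), p (\sum_(i <- s) F i) = \sum_(i <- s) p (F i)) ->
    cvgn (fun n => p (series u n)).
  move=> p_le p_sum.
  have -> : (fun n => p (series u n)) = series (fun k => p (u k)).
    by apply/funext => n; rewrite /series /= p_sum.
  apply: normed_cvg; apply: (series_le_cvg _ _ _ (is_cvg_series_exp_coeff N)).
  - by move=> n /=.
  - move=> n; rewrite /exp_coeff /= divr_ge0 // exprn_ge0 // -lecR NE.
    exact: (normr_ge0 z).
  move=> n /=; rewrite -lecR; apply: le_trans (p_le _) _.
  by rewrite /u /exp_coeff /= normrM normfV normrX normr_nat rmorphM fmorphV rmorphXn /= rmorph_nat NE.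
have sq (a b : R) : Num.sqrt (a ^+ 2) <= Num.sqrt (a ^+ 2 + b ^+ 2).
  by rewrite ler_sqrt ?lerDl ?sqr_ge0 // addr_ge0 ?sqr_ge0.
have cR : cvgn (fun n => complex.Re (series u n)).
  apply: part => [[a b]|s F]; last exact: Re_sum.
  by rewrite normc_def lecR /= -sqrtr_sqr sq.
have cI : cvgn (fun n => complex.Im (series u n)).
  apply: part => [[a b]|s F]; last exact: Im_sum.
  by rewrite normc_def lecR /= -sqrtr_sqr addrC sq.
have h := @cvg_complex (series u) _ _ cR cI.
by apply: cvgP h.
Qed.

Lemma complex_analytic_field : analytic_field complexField.
Proof. by split; [exact: complex_archi | exact: cexp_cvg]. Qed.

End ComplexLimits.

(** * Rational functions with poles on the diagonals *)

Section Coordinates.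
Variables (K : numClosedFieldType) (m : nat).
Implicit Types (L : 'rV[K]_m) (i j : 'I_m).

Definition generic L : Prop := injective (L 0).

Lemma generic_neq L i j : generic L -> i != j -> L 0 i != L 0 j.
Proof. by move=> gL; apply: contra_neq => /gL. Qed.

Lemma set_coordE i z L j : set_coord i z L 0 j = if j == i then z else L 0 j.
Proof. by rewrite mxE. Qed.

Lemma set_coord_id i L : set_coord i (L 0 i) L = L.
Proof. by apply/rowP => j; rewrite mxE; case: eqP => [->|]. Qed.

Lemma set_coord_shift i w L :
  set_coord i (L 0 i + w) L = w *: delta_mx 0 i + L.
Proof.
apply/rowP => j; rewrite !mxE eqxx /=; case: eqP => [->|_].
  by rewrite mulr1 addrC.
by rewrite mulr0 add0r.
Qed.

(** A collision with [L 0 j] would make [|w|] the distance from [L 0 i] to [L 0 j], and then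
    [|w| * s] would be at least 2. *)
Lemma generic_near i L : generic L -> exists2 s : K, 1 <= s &
  forall w, `|w| * s <= 1 -> generic (set_coord i (L 0 i + w) L).
Proof.
move=> gL; pose s : K := 1 + \sum_(j | j != i) 2 / `|L 0 j - L 0 i|.
have pos j : 0 <= 2 / `|L 0 j - L 0 i| by rewrite divr_ge0.
exists s => [|w ws]; first by rewrite lerDl sumr_ge0.
have nocoll j : j != i -> L 0 j != L 0 i + w.
  move=> ji; apply/eqP => jw; move: ws.
  have nw : `|w| = `|L 0 j - L 0 i| by rewrite jw addrAC subrr add0r.
  have w0 : 0 < `|w| by rewrite nw normr_gt0 subr_eq0 generic_neq.
  apply/negP; rewrite -real_ltNge ?realE ?ler01 ?mulr_ge0 ?addr_ge0 ?sumr_ge0 //.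
  apply: (@lt_le_trans _ _ (`|w| * (2 / `|w|))).
    by rewrite mulrC divfK ?gt_eqF // (ltr_nat _ 1 2).
  rewrite ler_wpM2l // /s (bigD1 j) //= -nw addrCA lerDl addr_ge0 //.
  by rewrite sumr_ge0.
move=> a b; rewrite !set_coordE; case: eqP => [->|/eqP ai]; case: eqP => [->|/eqP bi] //.
- by move/esym/eqP; rewrite (negPf (nocoll _ bi)).
- by move/eqP; rewrite (negPf (nocoll _ ai)).
- exact: gL.
Qed.

End Coordinates.

(* Locked: unfolding the limit would make unification diverge. *)
HB.lock Definition pderiv (K : numClosedFieldType) (m : nat) (i : 'I_m) : oper K m :=
  partial i.

Lemma partialE (K : numClosedFieldType) (m : nat) : @partial K m = @pderiv K m.
Proof. by rewrite unlock. Qed.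

Section RationalFunctions.
Variables (K : numClosedFieldType) (KA : analytic_field K).

Lemma hasder_eq (f g : K -> K) y d (s : K) : 1 <= s ->
  (forall w, `|w| * s <= 1 -> f (y + w) = g (y + w)) ->
  hasder g y d -> hasder f y d.
Proof. by move=> s1 fg [a ea <-]; exists a => //; exact: expands_eq s1 fg ea. Qed.

Section Fixed.
Variable m : nat.
Implicit Types (L : 'rV[K]_m) (i j : 'I_m) (f g : 'rV[K]_m -> K).

(** Partial derivatives are computed through this lemma: an expansion along the i-th coordinate line
    determines the limit in [partial]. *)
Lemma pderiv_hasder f i L d :
  hasder (fun z => f (set_coord i z L)) (L 0 i) d -> pderiv i f L = d.
Proof.
move=> [a ea <-]; have := expands_derive ea; rewrite set_coord_id => h.
rewrite -partialE /partial /derive; apply: (cvg_lim (@norm_hausdorff _ _)).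
apply: cvg_trans h; apply: near_eq_cvg; near=> w => /=.
by rewrite set_coord_shift.
Unshelve. all: by end_near.
Qed.

(* Poles are only allowed on the diagonals, so these functions are analytic at
   every generic point. *)
Inductive ratfun : ('rV[K]_m -> K) -> Prop :=
| ratfun_cst c : ratfun (fun=> c)
| ratfun_coord i : ratfun (fun L => L 0 i)
| ratfun_inv i j : i != j -> ratfun (fun L => (L 0 i - L 0 j)^-1)
| ratfun_add f g : ratfun f -> ratfun g -> ratfun (fun L => f L + g L)
| ratfun_mul f g : ratfun f -> ratfun g -> ratfun (fun L => f L * g L).

(** Agreement is required only at generic points: [principal] is controlled only off the
    diagonals. *)
Variant nice f : Prop := Nice g of ratfun g & forall L, generic L -> f L = g L.

Lemma hasder_coord i j L :
  hasder (fun z => set_coord i z L 0 j) (L 0 i) (j == i)%:R.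
Proof.
rewrite (_ : (fun z => _) = (if j == i then id else fun=> L 0 j)); last first.
  by apply/funext => z; rewrite set_coordE; case: ifP.
by case: ifP => _; [exact: hasder_id | exact: hasder_cst].
Qed.

Lemma hasder_coord_inv i a b L : generic L -> a != b ->
  hasder (fun z => (set_coord i z L 0 a - set_coord i z L 0 b)^-1) (L 0 i)
    (((b == i)%:R - (a == i)%:R) * (L 0 a - L 0 b) ^- 2).
Proof.
move=> gL ab; have [ai|ai] := eqVneq a i; have [bi|bi] := eqVneq b i.
- by rewrite ai bi eqxx in ab.
- rewrite (_ : (fun z => _) = (fun z => (-1) * (L 0 b - z)^-1)); last first.
    apply/funext => z; rewrite !set_coordE ai eqxx (negPf bi) mulN1r -invrN.
    by rewrite opprB.
  rewrite ai sub0r -[(_ - _) ^+ 2]sqrrN opprB.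
  have := hasderM KA (hasder_cst (-1) (L 0 i)) (hasder_inv KA (generic_neq gL bi)).
  by rewrite mul0r addr0.
- rewrite (_ : (fun z => _) = (fun z => (L 0 a - z)^-1)); last first.
    by apply/funext => z; rewrite !set_coordE bi eqxx (negPf ai).
  by rewrite subr0 mul1r bi; apply: hasder_inv => //; rewrite -bi generic_neq // bi.
- rewrite subrr mul0r (_ : (fun z => _) = (fun=> (L 0 a - L 0 b)^-1)).
    exact: hasder_cst.
  by apply/funext => z; rewrite !set_coordE (negPf ai) (negPf bi).
Qed.

(** Induction on the rational expression. The expansion passes from [g] to [f] because a generic
    point stays generic when one coordinate moves a little. *)
Lemma nice_hasder f i L : nice f -> generic L ->
  hasder (fun z => f (set_coord i z L)) (L 0 i) (pderiv i f L).
Proof.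
move=> [g rg fg] gL; suff [d fd] : exists d, hasder (fun z => f (set_coord i z L)) (L 0 i) d.
  by rewrite (pderiv_hasder fd).
have [s s1 sg] := generic_near i gL.
suff [d gd] : exists d, hasder (fun z => g (set_coord i z L)) (L 0 i) d.
  by exists d; apply: hasder_eq s1 _ gd => w ws; apply: fg; apply: sg.
elim: rg => {g fg} [c|a|a b ab|f1 f2 _ [d1 h1] _ [d2 h2]|f1 f2 _ [d1 h1] _ [d2 h2]].
- by exists 0; exact: hasder_cst.
- by eexists; exact: hasder_coord.
- by eexists; exact: hasder_coord_inv.
- by eexists; exact: hasderD h1 h2.
- by eexists; exact: hasderM h1 h2.
Qed.

Lemma ratfun_nice f : ratfun f -> nice f. Proof. by exists f. Qed.

Lemma nice_eq f g : (forall L, generic L -> f L = g L) -> nice g -> nice f.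
Proof. by move=> fg [h rh gh]; exists h => // L gL; rewrite fg ?gh. Qed.

Lemma nice_cst c : nice (fun=> c). Proof. exact/ratfun_nice/ratfun_cst. Qed.

Lemma nice_coord i : nice (fun L => L 0 i).
Proof. exact/ratfun_nice/ratfun_coord. Qed.

Lemma nice_inv i j : i != j -> nice (fun L => (L 0 i - L 0 j)^-1).
Proof. by move=> ij; exact/ratfun_nice/ratfun_inv. Qed.

Lemma niceD f g : nice f -> nice g -> nice (fun L => f L + g L).
Proof.
move=> [f' rf ff] [g' rg gg]; exists (fun L => f' L + g' L); first exact: ratfun_add.
by move=> L gL; rewrite ff ?gg.
Qed.

Lemma niceM f g : nice f -> nice g -> nice (fun L => f L * g L).
Proof.
move=> [f' rf ff] [g' rg gg]; exists (fun L => f' L * g' L); first exact: ratfun_mul.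
by move=> L gL; rewrite ff ?gg.
Qed.

Lemma niceX f n : nice f -> nice (fun L => f L ^+ n).
Proof.
move=> nf; elim: n => [|n IH]; first exact: nice_cst.
by apply: nice_eq (niceM nf IH) => L _; rewrite exprS.
Qed.

Lemma nice_sum (I : Type) (s : seq I) (P : pred I) (F : I -> 'rV[K]_m -> K) :
  (forall k, P k -> nice (F k)) -> nice (fun L => \sum_(k <- s | P k) F k L).
Proof.
move=> nF; elim: s => [|i s IH].
  by apply: nice_eq (nice_cst 0) => L _; rewrite big_nil.
have [Pi|Pi] := boolP (P i).
  by apply: nice_eq (niceD (nF i Pi) IH) => L _; rewrite big_cons Pi.
by apply: nice_eq IH => L _; rewrite big_cons (negPf Pi).
Qed.

Lemma nice_prod (I : Type) (s : seq I) (P : pred I) (F : I -> 'rV[K]_m -> K) :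
  (forall k, P k -> nice (F k)) -> nice (fun L => \prod_(k <- s | P k) F k L).
Proof.
move=> nF; elim: s => [|i s IH].
  by apply: nice_eq (nice_cst 1) => L _; rewrite big_nil.
have [Pi|Pi] := boolP (P i).
  by apply: nice_eq (niceM (nF i Pi) IH) => L _; rewrite big_cons Pi.
by apply: nice_eq IH => L _; rewrite big_cons (negPf Pi).
Qed.

Lemma pderiv_eq i f g L : nice g -> (forall L, generic L -> f L = g L) ->
  generic L -> pderiv i f L = pderiv i g L.
Proof.
move=> ng fg gL; have [s s1 sg] := generic_near i gL.
apply: pderiv_hasder; apply: hasder_eq s1 _ (nice_hasder i ng gL).
by move=> w ws; apply: fg; apply: sg.
Qed.

Lemma pderiv_cst i c L : pderiv i (fun=> c) L = 0.
Proof. by apply: pderiv_hasder; exact: hasder_cst. Qed.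

Lemma pderiv_coord i j L : pderiv i (fun L => L 0 j) L = (j == i)%:R.
Proof. by apply: pderiv_hasder; exact: hasder_coord. Qed.

Lemma pderiv_inv i a b L : generic L -> a != b ->
  pderiv i (fun L => (L 0 a - L 0 b)^-1) L =
    ((b == i)%:R - (a == i)%:R) * (L 0 a - L 0 b) ^- 2.
Proof. by move=> gL ab; apply: pderiv_hasder; exact: hasder_coord_inv. Qed.

Lemma pderivD i f g L : nice f -> nice g -> generic L ->
  pderiv i (fun L => f L + g L) L = pderiv i f L + pderiv i g L.
Proof.
by move=> nf ng gL; apply: pderiv_hasder; apply: hasderD; exact: nice_hasder.
Qed.

Lemma pderivM i f g L : nice f -> nice g -> generic L ->
  pderiv i (fun L => f L * g L) L = f L * pderiv i g L + pderiv i f L * g L.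
Proof.
move=> nf ng gL; apply: pderiv_hasder.
have := hasderM KA (nice_hasder i nf gL) (nice_hasder i ng gL).
by rewrite set_coord_id.
Qed.

Lemma pderivZ i c f L : nice f -> generic L ->
  pderiv i (fun L => c * f L) L = c * pderiv i f L.
Proof.
by move=> nf gL; rewrite pderivM ?pderiv_cst ?mul0r ?addr0 //; exact: nice_cst.
Qed.

(** The derivative of an inverse difference is a constant times its square, so the class is closed
    under differentiation. *)
Lemma nice_pderiv i f : nice f -> nice (pderiv i f).
Proof.
move=> [f' rf ff].
apply: (@nice_eq _ (pderiv i f')) => [L gL|].
  by apply: pderiv_eq => //; exact: ratfun_nice.
elim: rf => {f f' ff} [c|j|a b ab|f g rf nf rg ng|f g rf nf rg ng].
- by apply: nice_eq (nice_cst 0) => L _; exact: pderiv_cst.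
- by apply: nice_eq (nice_cst (j == i)%:R) => L _; exact: pderiv_coord.
- apply: (@nice_eq _ (fun L => ((b == i)%:R - (a == i)%:R) * (L 0 a - L 0 b)^-1 ^+ 2)).
    by move=> L gL; rewrite pderiv_inv // exprVn.
  by apply: niceM; [exact: nice_cst | apply: niceX; exact: nice_inv].
- apply: nice_eq (niceD nf ng) => L gL.
  by apply: pderivD => //; exact: ratfun_nice.
- apply: nice_eq (niceD (niceM (ratfun_nice rf) ng) (niceM nf (ratfun_nice rg))) => L gL.
  by apply: pderivM => //; exact: ratfun_nice.
Qed.

(** With expansions in one variable only, symmetry is proved by induction on the rational
    expression: each case computes the second derivative in a form symmetric in the two indices. *)
Lemma pderivC i j f L : nice f -> generic L ->
  pderiv i (pderiv j f) L = pderiv j (pderiv i f) L.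
Proof.
move=> [f' rf ff] gL.
have step a b : pderiv a (pderiv b f) L = pderiv a (pderiv b f') L.
  apply: pderiv_eq => //; first exact/nice_pderiv/ratfun_nice.
  by move=> L' gL'; apply: pderiv_eq => //; exact: ratfun_nice.
rewrite (step i j) (step j i) {step}.
elim: rf {f ff} => [c|k|a b ab|f g rf cf rg cg|f g rf cf rg cg].
- have c0 a b : pderiv a (pderiv b (fun=> c)) L = 0.
    rewrite (@pderiv_eq _ _ (fun=> 0)) ?pderiv_cst //; first exact: nice_cst.
    by move=> L' _; rewrite pderiv_cst.
  by rewrite !c0.
- have c0 a b : pderiv a (pderiv b (fun L => L 0 k)) L = 0.
    rewrite (@pderiv_eq _ _ (fun=> (k == b)%:R)) ?pderiv_cst //; first exact: nice_cst.
    by move=> L' _; rewrite pderiv_coord.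
  by rewrite !c0.
- have ni := nice_inv ab.
  have c0 k l : pderiv k (pderiv l (fun L => (L 0 a - L 0 b)^-1)) L =
    ((b == l)%:R - (a == l)%:R) * (((b == k)%:R - (a == k)%:R) * (2 * (L 0 a - L 0 b)^-1 ^+ 3)).
    rewrite (@pderiv_eq _ _ (fun L => ((b == l)%:R - (a == l)%:R) *
      ((L 0 a - L 0 b)^-1 * (L 0 a - L 0 b)^-1))) //.
    - rewrite pderivZ //; last exact: niceM.
      by rewrite pderivM // pderiv_inv // -!exprVn; ring.
    - by apply: niceM; [exact: nice_cst | exact: niceM].
    - by move=> L' gL'; rewrite pderiv_inv // -exprVn.
  by rewrite (c0 i j) (c0 j i) mulrCA.
- have nf := ratfun_nice rf; have ng := ratfun_nice rg.
  have c0 k l : pderiv k (pderiv l (fun L => f L + g L)) L =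
     pderiv k (pderiv l f) L + pderiv k (pderiv l g) L.
    have nf' := nice_pderiv l nf; have ng' := nice_pderiv l ng.
    apply: etrans (pderivD k nf' ng' gL).
    by apply: (pderiv_eq k (niceD nf' ng') _ gL) => L' gL'; exact: pderivD.
  by rewrite (c0 i j) (c0 j i) cf cg.
- have nf := ratfun_nice rf; have ng := ratfun_nice rg.
  have c0 k l : pderiv k (pderiv l (fun L => f L * g L)) L =
     (f L * pderiv k (pderiv l g) L + pderiv k f L * pderiv l g L) +
     (pderiv l f L * pderiv k g L + pderiv k (pderiv l f) L * g L).
    have nf' := nice_pderiv l nf; have ng' := nice_pderiv l ng.
    rewrite -(pderivM k nf ng' gL) -(pderivM k nf' ng gL).
    apply: etrans (pderivD k (niceM nf ng') (niceM nf' ng) gL).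
    apply: (pderiv_eq k (niceD (niceM nf ng') (niceM nf' ng)) _ gL) => L' gL'.
    exact: pderivM.
  by rewrite (c0 i j) (c0 j i) cf cg addrACA.
Qed.

End Fixed.

Lemma generic_front m (y : 'rV[K]_m.+1) : generic y -> generic (front y).
Proof.
move=> gy i j; rewrite !mxE => /gy /(congr1 val) /= ij; exact: val_inj.
Qed.

Lemma nice_front m (f : 'rV[K]_m -> K) : nice f -> nice (fun y => f (front y)).
Proof.
move=> [g rg fg]; apply: (@nice_eq _ _ (fun y => g (front y))).
  by move=> y gy; apply: fg; exact: generic_front.
have wE i y : front y 0 i = y 0 (widen_ord (leqnSn m) i) by rewrite mxE.
elim: rg {f fg} => [c|i|i j ij|f1 f2 _ h1 _ h2|f1 f2 _ h1 _ h2].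
- exact: nice_cst.
- by apply: nice_eq (nice_coord (widen_ord (leqnSn m) i)) => y _; rewrite wE.
- have ij' : widen_ord (leqnSn m) i != widen_ord (leqnSn m) j.
    by apply: contra_neq ij => /(congr1 val) /= ij; exact: val_inj.
  by apply: nice_eq (nice_inv ij') => y _; rewrite !wE.
- exact: niceD h1 h2.
- exact: niceM h1 h2.
Qed.

End RationalFunctions.

(** * The iterated residue *)

Section IteratedResidue.
Variables (K : numClosedFieldType) (KA : analytic_field K).

Lemma residue_hasder (f g : K -> K) y d (s : K) : hasder g y d -> 1 <= s ->
  (forall w, w != 0 -> `|w| * s <= 1 -> f (y + w) = g (y + w) / w ^+ 2) ->
  residue f y = d.
Proof. by move=> [a ea <-] s1 fg; exact: residue_expands ea s1 fg. Qed.

(** Logarithmic derivatives add up; writing a derivative as the value times [l i] avoids dividing by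
    a factor that may vanish. *)
Lemma hasder_logprod (I : Type) (s : seq I) (P : pred I) (F : I -> K -> K)
    (l : I -> K) y :
  (forall i, P i -> hasder (F i) y (F i y * l i)) ->
  hasder (fun z => \prod_(i <- s | P i) F i z) y
    ((\prod_(i <- s | P i) F i y) * \sum_(i <- s | P i) l i).
Proof.
move=> Fl; elim: s => [|i s IH].
  rewrite !big_nil mulr0 (_ : (fun z => _) = (fun=> 1)); first exact: hasder_cst.
  by apply/funext => z; rewrite big_nil.
have [Pi|Pi] := boolP (P i); last first.
  rewrite !big_cons (negPf Pi) (_ : (fun z => _) = (fun z => \prod_(j <- s | P j) F j z)) //.
  by apply/funext => z; rewrite big_cons (negPf Pi).
rewrite !big_cons Pi (_ : (fun z => _) = (fun z => F i z * \prod_(j <- s | P j) F j z)).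
  set S := \sum_(j <- s | P j) l j; set p := \prod_(j <- s | P j) F j y.
  have -> : F i y * p * (l i + S) = F i y * (p * S) + F i y * l i * p by ring.
  exact: (hasderM KA (Fl i Pi) IH).
by apply/funext => z; rewrite big_cons Pi.
Qed.

Section Operators.
Variable m : nat.
Implicit Types (L y : 'rV[K]_m) (i j : 'I_m) (s : seq 'I_m) (P Q : 'rV[K]_m -> K).

Lemma op_prodE (T : 'I_m -> oper K m) (f : 'rV[K]_m -> K) :
  op_prod T f = foldr T f (index_enum 'I_m).
Proof.
rewrite /op_prod; elim: (index_enum _) => [|i s IH]; first by rewrite big_nil.
by rewrite big_cons /= IH.
Qed.

Definition shifted (c : 'I_m -> K) i : oper K m :=
  fun f a => c i * f a + pderiv i f a.

(** The coefficients [c] are constants, so the derivatives act on [P] alone. Coefficients depending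
    on [y] are evaluated before being passed as [c]. *)
Definition frozen c s P := foldr (shifted c) P s.

Lemma nice_shifted c i f : nice f -> nice (shifted c i f).
Proof.
move=> nf; apply: niceD; last exact: nice_pderiv.
by apply: niceM => //; exact: nice_cst.
Qed.

Lemma nice_frozen c s P : nice P -> nice (frozen c s P).
Proof. by move=> nP; elim: s => //= i s IH; exact: nice_shifted. Qed.

Lemma pderiv_frozen c s P j L : nice P -> generic L ->
  pderiv j (frozen c s P) L = frozen c s (pderiv j P) L.
Proof.
move=> nP; elim: s L => [//|i s IH] L gL /=.
have nF := nice_frozen c s nP.
rewrite pderivD //; last 2 first.
- by apply: niceM => //; exact: nice_cst.
- exact: nice_pderiv.
rewrite pderivZ // IH // pderivC // /shifted; congr (_ + _).
apply: pderiv_eq => //; apply: nice_frozen; exact: nice_pderiv.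
Qed.

Lemma frozen_cons c i s P L : nice P -> generic L ->
  frozen c (i :: s) P L = c i * frozen c s P L + frozen c s (pderiv i P) L.
Proof. by move=> nP gL; rewrite -pderiv_frozen. Qed.

Lemma frozen_eq c s P Q L : nice Q -> (forall L, generic L -> P L = Q L) ->
  generic L -> frozen c s P L = frozen c s Q L.
Proof.
move=> nQ PQ; elim: s L => [|i s IH] L gL /=; first exact: PQ.
by rewrite /shifted IH // (pderiv_eq KA i (nice_frozen c s nQ)).
Qed.

Definition set_coords s y L : 'rV[K]_m := \row_j (if j \in s then y 0 j else L 0 j).

(** [d] is the inverse radius of a polydisc on which [F] factors. The residue in the i-th variable
    is the derivative at [y_i] of [w i] times the function already obtained, which gives the factor
    [w i (y 0 i)] and the operator [c i + d_i]. *)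
Lemma iter_residueE (F P : 'rV[K]_m -> K) (w : 'I_m -> K -> K) (c : 'I_m -> K) y (d : K) :
  1 <= d -> nice P ->
  (forall i, hasder (w i) (y 0 i) (w i (y 0 i) * c i)) ->
  (forall L, (forall i, `|L 0 i - y 0 i| * d <= 1) -> generic L) ->
  (forall L, (forall i, `|L 0 i - y 0 i| * d <= 1) ->
     F L = P L * \prod_i (w i (L 0 i) / (L 0 i - y 0 i) ^+ 2)) ->
  iter_residue F y = (\prod_i w i (y 0 i)) * frozen c (index_enum 'I_m) P y.
Proof.
move=> d1 nP wc near_gen FE; rewrite /iter_residue op_prodE.
have sub0d : `|0 : K| * d <= 1 by rewrite normr0 mul0r.
have gen_set s L : (forall j, j \notin s -> `|L 0 j - y 0 j| * d <= 1) ->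
    generic (set_coords s y L).
  move=> Ls; apply: near_gen => j; rewrite mxE; case: ifPn => js; last exact: Ls.
  by rewrite subrr.
(* Invariant once the residues over [s] are taken: the variables outside [s] are free, near [y] but
   different from it, and still carry their double poles. *)
suff main s L : uniq s ->
    (forall j, j \notin s -> `|L 0 j - y 0 j| * d <= 1 /\ L 0 j != y 0 j) ->
    foldr (fun i => res_op i (y 0 i)) F s L =
      (\prod_(j | j \notin s) (w j (L 0 j) / (L 0 j - y 0 j) ^+ 2)) *
      (\prod_(j <- s) w j (y 0 j)) * frozen c s P (set_coords s y L).
  rewrite main ?index_enum_uniq // => [|j]; last by rewrite mem_index_enum.
  rewrite big_pred0 ?mul1r => [|j]; last by rewrite mem_index_enum.
  by congr (_ * frozen c _ P _); apply/rowP => j; rewrite mxE mem_index_enum.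
elim: s L => [|i s IH] L /=.
  move=> _ Ls; rewrite FE => [|j]; last by case: (Ls j).
  rewrite big_nil mulr1 mulrC; congr (_ * P _).
  by apply/rowP => j; rewrite mxE.
move=> /andP [is_ us] Ls.
set M := set_coords (i :: s) y L.
have Mi : M 0 i = y 0 i by rewrite mxE mem_head.
have gM : generic M by apply: gen_set => j /Ls [].
(* [A] gathers the factors that do not depend on the i-th variable. *)
pose A := (\prod_(j | j \notin i :: s) (w j (L 0 j) / (L 0 j - y 0 j) ^+ 2)) *
  \prod_(j <- s) w j (y 0 j).
have nF := nice_frozen c s nP.
have hQ := nice_hasder KA i nF gM; rewrite Mi in hQ.
have hw := hasderM KA (hasder_cst A (y 0 i)) (hasderM KA hQ (wc i)).
rewrite /res_op (residue_hasder hw d1) => [|z z0 zd].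
  rewrite mul0r addr0 -[in X in set_coord _ X _]Mi set_coord_id big_cons /A /shifted.
  by ring.
have Lz j : j \notin s -> `|set_coord i (y 0 i + z) L 0 j - y 0 j| * d <= 1 /\
    set_coord i (y 0 i + z) L 0 j != y 0 j.
  move=> js; rewrite set_coordE; case: eqP => [->|/eqP ji].
    by rewrite addrAC subrr add0r -subr_eq0 addrAC subrr add0r.
  by apply: Ls; rewrite inE negb_or ji.
rewrite IH // (bigD1 i) //= set_coordE eqxx [y 0 i + z - _]addrAC subrr add0r.
have -> : set_coords s y (set_coord i (y 0 i + z) L) = set_coord i (y 0 i + z) M.
  apply/rowP => j; rewrite !mxE inE; case: eqP => [->|//] /=.
  by rewrite (negPf is_).
have -> : \prod_(j | (j \notin s) && (j != i))
    (w j (set_coord i (y 0 i + z) L 0 j) / (set_coord i (y 0 i + z) L 0 j - y 0 j) ^+ 2) =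
  \prod_(j | j \notin i :: s) (w j (L 0 j) / (L 0 j - y 0 j) ^+ 2).
  apply: eq_big => [j|j /andP [_ ji]]; first by rewrite inE negb_or andbC.
  by rewrite set_coordE (negPf ji).
by rewrite /A; ring.
Qed.

End Operators.

Lemma vdm_front m (y : 'rV[K]_m.+1) :
  vdm y = vdm (front y) * \prod_(i < m) (y 0 ord_max - front y 0 i).
Proof.
rewrite /vdm big_ord_recr /=; congr (_ * _).
  apply: eq_bigr => i _; rewrite big_mkcond big_ord_recr /= ltnNge ltnW ?mulr1 //=.
  by rewrite [RHS]big_mkcond; apply: eq_bigr => j _; rewrite !mxE.
rewrite big_mkcond big_ord_recr /= ltnn mulr1.
by apply: eq_bigr => j _; rewrite ltn_ord mxE.
Qed.

(** Each unordered pair contributes a fourth power, shared equally by the two ordered pairs. This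
    form matches the double poles of the integrand. *)
Lemma vdm4 m (y : 'rV[K]_m) :
  vdm y ^+ 4 = \prod_i \prod_(k | k != i) (y 0 k - y 0 i) ^+ 2.
Proof.
have -> : vdm y ^+ 4 = (vdm y ^+ 2) * (vdm y ^+ 2) by rewrite -exprD.
have v2 : vdm y ^+ 2 = \prod_(i < m) \prod_(k < m | (k < i)%N) (y 0 k - y 0 i) ^+ 2.
  rewrite -prodrXl; apply: eq_bigr => i _; rewrite -prodrXl; apply: eq_bigr => k _.
  by rewrite -sqrrN opprB.
rewrite {2}v2 (exchange_big_dep xpredT) //= {1}v2 -big_split; apply: eq_bigr => i _ /=.
rewrite [RHS](bigID (fun k : 'I_m => (k < i)%N)) /=; congr (_ * _).
  by apply: eq_bigl => k; rewrite -(inj_eq val_inj) /=; case: ltngtP.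
apply: eq_big => [k|k _]; first by rewrite -(inj_eq val_inj) /=; case: ltngtP.
by rewrite -sqrrN opprB.
Qed.


(** The logarithmic derivative of [weight x y i] at [y_i]. *)
Definition drift m (x y : 'rV[K]_m.+1) (i : 'I_m) : K :=
  front x 0 i - x 0 ord_max
  - \sum_(k < m.+1 | (k != i :> nat)) 2 / (front y 0 i - y 0 k).

(** The part of the integrand that depends on [L_i] alone, without its double pole at [y_i]. *)
Definition weight m (x y : 'rV[K]_m.+1) (i : 'I_m) (z : K) : K :=
  cexp ((front x 0 i - x 0 ord_max) * (z - front y 0 i)) *
  \prod_(k < m.+1 | (k != i :> nat)) ((y 0 k - z)^-1 * (y 0 k - z)^-1).

Lemma hasder_weight m (x y : 'rV[K]_m.+1) (i : 'I_m) : generic y ->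
  hasder (weight x y i) (front y 0 i)
    (weight x y i (front y 0 i) * drift x y i).
Proof.
move=> gy; set c := front x 0 i - x 0 ord_max; set u := front y 0 i.
have hF (k : 'I_m.+1) : (k != i :> nat) ->
    hasder (fun z => (y 0 k - z)^-1 * (y 0 k - z)^-1) u
      ((y 0 k - u)^-1 * (y 0 k - u)^-1 * - (2 / (u - y 0 k))).
  move=> ki; have ku : y 0 k != u.
    rewrite /u mxE; apply: generic_neq => //; apply: contra ki => /eqP ->.
  have := hasderM KA (hasder_inv KA ku) (hasder_inv KA ku).
  set e := _ + _; set e' := (X in _ -> hasder _ _ X); suff -> : e = e' by [].
  have d0 : y 0 k - u != 0 by rewrite subr_eq0.
  rewrite /e /e' -[u - _]opprB; move: (y 0 k - u) d0 => t t0; by field.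
have := hasderM KA (hasder_cexp KA c u) (hasder_logprod (index_enum _) hF).
set p := \prod_(k | _) _; set S := \sum_(k | _) _.
have -> : S = - \sum_(k < m.+1 | (k != i :> nat)) 2 / (u - y 0 k) by rewrite /S -sumrN.
have -> : weight x y i u = p by rewrite /weight subrr mulr0 cexp0 ?mul1r.
rewrite subrr mulr0 cexp0 // mul1r.
set e := p * _ + _; suff -> : e = p * drift x y i by [].
by rewrite /e /drift -/c -/u mulrBr mulrN mulrC addrC [c * p]mulrC.
Qed.

Lemma weight_at m (x y : 'rV[K]_m.+1) (i : 'I_m) :
  weight x y i (front y 0 i) =
    \prod_(k < m.+1 | (k != i :> nat)) (y 0 k - front y 0 i) ^- 2.
Proof.
rewrite /weight subrr mulr0 cexp0 // mul1r; apply: eq_bigr => k _.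
by rewrite -exprVn.
Qed.

(** The weights cancel the Vandermonde factors among the first [m] points, and [(y_i - y_n) ^ 4]
    loses two of its four powers. *)
Lemma vdm4_weights m (x y : 'rV[K]_m.+1) : generic y ->
  vdm y ^+ 4 * \prod_i weight x y i (front y 0 i) =
  \prod_(i < m) (front y 0 i - y 0 ord_max) ^+ 2.
Proof.
move=> gy; rewrite vdm_front exprMn vdm4 -prodrXl -!big_split.
apply: eq_bigr => i _ /=; rewrite weight_at [X in _ * X]big_mkcond big_ord_recr /=.
rewrite gtn_eqF //= -[X in _ * (X * _)]big_mkcond /=.
have yE (k : 'I_m) : y 0 (widen_ord (leqnSn m) k) = front y 0 k by rewrite mxE.
have -> : \prod_(k < m | (k != i :> nat)) (y 0 (widen_ord (leqnSn m) k) - front y 0 i) ^- 2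
   = (\prod_(k < m | k != i) (front y 0 k - front y 0 i) ^+ 2)^-1.
  by rewrite -prodfV; apply: eq_bigr => k _; rewrite yE.
set p := \prod_(k | _) _; have p0 : p != 0.
  apply/prodf_neq0 => k ki; rewrite expf_neq0 // subr_eq0.
  by apply: generic_neq => //; exact: generic_front.
have n0 : y 0 ord_max - front y 0 i != 0.
  rewrite subr_eq0 mxE; apply: generic_neq => //; rewrite -(inj_eq val_inj) /=.
  by rewrite gtn_eqF.
rewrite -[front y 0 i - _]opprB; move: (_ - _) p n0 p0 => t q t0 q0.
by field; rewrite t0 q0.
Qed.

(** Niceness of the smaller term is a hypothesis, because it comes from an induction that uses this
    very formula. *)
Lemma principal_formula m (x y : 'rV[K]_m.+1) : (0 < m)%N -> generic y ->
  nice (principal (front x)) ->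
  principal x y =
    (\prod_(i < m) ((front x 0 i - x 0 ord_max) * (front y 0 i - y 0 ord_max) ^+ 2)) *
    frozen (drift x y) (index_enum 'I_m) (principal (front x)) (front y).
Proof.
move=> m0 gy nP; rewrite [LHS]/= gtn_eqF //=.
pose c i := front x 0 i - x 0 ord_max.
(* The exponential part of [d] lets [cexp] split over the sum. The gaps keep [L] generic: two
   coordinates move by at most [1 / d] each, and 3 exceeds 2. At [k = i] the gap is 3 / 0 = 0. *)
pose gap (i : 'I_m) (k : 'I_m.+1) := 3 / `|front y 0 i - y 0 k|.
pose d : K := 1 + (\sum_i `|c i|) *+ 8 + \sum_i \sum_k gap i k.
have gap0 i k : 0 <= gap i k by rewrite divr_ge0.
have sc0 : 0 <= (\sum_i `|c i|) *+ 8 by rewrite mulrn_wge0 // sumr_ge0.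
have sg0 : 0 <= \sum_i \sum_k gap i k by rewrite sumr_ge0 // => i _; rewrite sumr_ge0.
have d1 : 1 <= d by rewrite /d -addrA lerDl addr_ge0.
have d0 : 0 < d by apply: lt_le_trans d1.
have gapd i k : gap i k <= d.
  apply: (@le_trans _ _ (\sum_i \sum_k gap i k)); last by rewrite lerDr addr_ge0.
  rewrite (bigD1 i) //= (bigD1 k) //= -addrA lerDl addr_ge0 ?sumr_ge0 // => j _.
  by rewrite sumr_ge0.
have near_gen (L : 'rV[K]_m) : (forall i, `|L 0 i - front y 0 i| * d <= 1) -> generic L.
  move=> Ld i j Lij; apply/eqP; apply: contraT => ij.
  have yij : front y 0 i - front y 0 j != 0.
    by rewrite subr_eq0; apply: generic_neq => //; exact: generic_front.
  have n0 : 0 < `|front y 0 i - front y 0 j| by rewrite normr_gt0.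
  have : `|front y 0 i - front y 0 j| * d <= 2.
    have -> : front y 0 i - front y 0 j = (L 0 j - front y 0 j) - (L 0 i - front y 0 i).
      by rewrite Lij; ring.
    apply: le_trans (_ : (`|L 0 j - front y 0 j| + `|L 0 i - front y 0 i|) * d <= _).
      by rewrite ler_pM2r // ler_normB.
    by rewrite mulrDl (_ : 2 = 1 + 1) // lerD.
  have := gapd i (widen_ord (leqnSn m) j); rewrite /gap.
  have -> : y 0 (widen_ord (leqnSn m) j) = front y 0 j by rewrite mxE.
  rewrite ler_pdivrMr // mulrC => /le_trans h /h.
  by rewrite (ler_nat _ 3 2).
rewrite (@iter_residueE _ _ (principal (front x)) (weight x y) (drift x y) _ d) //.
- rewrite [X in _ = X * _]big_split /= -(vdm4_weights x gy).
  set A := \prod_(i < m) (_ - _); set B := \prod_i _; set F := frozen _ _ _ _.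
  by rewrite [vdm y ^+ 4 * A]mulrC -!mulrA.
- by move=> i; exact: hasder_weight.
move=> L Ld; rewrite cexp_sum //; last first.
  apply: le_trans (_ : \sum_i `|c i| / d *+ 8 <= _).
    rewrite -sumrMnl; apply: ler_sum => i _; rewrite ler_pMn2r // normrM.
    by rewrite ler_wpM2l // -div1r ler_pdivlMr.
  rewrite sumrMnl -mulr_suml -mulrnAl ler_pdivrMr // mul1r /d.
  by rewrite addrAC lerDr addr_ge0.
rewrite (exchange_big_dep xpredT) //= -prodfV -[principal _ _ * _ * _]mulrA mulrCA -!big_split /=.
congr (_ * _); apply: eq_bigr => i _; rewrite /weight mulrC -!mulrA; congr (_ * (_ * _)).
rewrite -prodfV; apply: eq_big => [k|k _]; first by rewrite eq_sym.
by rewrite -exprVn expr2.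
Qed.

End IteratedResidue.

(** * Rationality of the principal term off the diagonals *)

Section PrincipalNice.
Variables (K : numClosedFieldType) (KA : analytic_field K).

(** The coefficients now vary with [y]. Unfolding by [frozen_cons] puts the derivative on [P], so
    the induction is over all [P]. *)
Lemma nice_frozen_front m (c : 'rV[K]_m.+1 -> 'I_m -> K) s (P : 'rV[K]_m -> K) :
  (forall i, nice (fun y => c y i)) -> nice P ->
  nice (fun y => frozen (c y) s P (front y)).
Proof.
move=> nc; elim: s P => [|i s IH] P nP; first exact: nice_front.
apply: nice_eq (niceD (niceM (nc i) (IH P nP)) (IH _ (nice_pderiv KA i nP))).
by move=> y gy; rewrite frozen_cons //; exact: generic_front.
Qed.

(** Niceness for [m] variables validates the first formula for [m + 1] variables, whose right-hand
    side is visibly nice. *)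
Lemma nice_principal n (x : 'rV[K]_n) : nice (principal x).
Proof.
elim: n x => [|m IH] x; first exact: nice_cst.
have [m0|m0] := eqVneq m 0%N.
  by apply: nice_eq (nice_cst _ 1) => y _ /=; rewrite ifT // m0.
apply: (@nice_eq _ _ _ (fun y => (\prod_(i < m) ((front x 0 i - x 0 ord_max) * (front y 0 i - y 0 ord_max) ^+ 2)) *
    frozen (drift x y) (index_enum 'I_m) (principal (front x)) (front y))).
  by move=> y gy; rewrite principal_formula // lt0n.
have widenE (y : 'rV[K]_m.+1) (i : 'I_m) : front y 0 i = y 0 (widen_ord (leqnSn m) i).
  by rewrite mxE.
apply: niceM; last first.
  apply: nice_frozen_front => // i.
  apply: (@nice_eq _ _ _ (fun y => front x 0 i - x 0 ord_max +
    (-1) * \sum_(k < m.+1 | (k != i :> nat)) 2 * (y 0 (widen_ord (leqnSn m) i) - y 0 k)^-1)).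
    by move=> y gy; rewrite mulN1r; congr (_ - _); apply: eq_bigr => k _; rewrite widenE.
  apply: niceD; first exact: nice_cst.
  apply: niceM; first exact: nice_cst.
  apply: nice_sum => k ki; apply: niceM; first exact: nice_cst.
  by apply: nice_inv; rewrite -(inj_eq val_inj) /= eq_sym.
apply: nice_prod => i _; apply: niceM; first exact: nice_cst.
apply: niceX; apply: (@nice_eq _ _ _ (fun y => y 0 (widen_ord (leqnSn m) i) + (-1) * y 0 ord_max)).
  by move=> y gy; rewrite mulN1r widenE.
apply: niceD; first exact: nice_coord.
by apply: niceM; [exact: nice_cst | exact: nice_coord].
Qed.

End PrincipalNice.

(** * Determinants of the coupling matrix *)

Section Splittings.
Variable T : eqType.
Implicit Types (l A C : seq T) (i j : T).

(** All ways to deal [l] into two sublists, later the fixed and the displaced points. Both keep the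
    order of [l], so operators indexed by the first stay in index order. *)
Fixpoint splits l : seq (seq T * seq T) :=
  if l is i :: l' then
    [seq (i :: p.1, p.2) | p <- splits l'] ++ [seq (p.1, i :: p.2) | p <- splits l']
  else [:: ([::], [::])].

Variable V : nmodType.

Lemma big_splits_cons i l (F : seq T * seq T -> V) :
  \sum_(p <- splits (i :: l)) F p =
  \sum_(p <- splits l) (F (i :: p.1, p.2) + F (p.1, i :: p.2)).
Proof. by rewrite big_split /= big_cat !big_map. Qed.

Lemma splits_sub l p i : p \in splits l -> (i \in p.1) || (i \in p.2) -> i \in l.
Proof.
elim: l p => [|j l IH] p /=; first by rewrite inE => /eqP ->.
rewrite mem_cat => /orP [] /mapP [q /IH ql ->] /=; rewrite !inE.
  by case: eqP => //= _ /ql.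
by case: eqP => //= _; rewrite ?orbF => /ql.
Qed.

Lemma splits_uniq l p : uniq l -> p \in splits l -> uniq p.2.
Proof.
elim: l p => [|j l IH] p /=; first by rewrite inE => _ /eqP ->.
move=> /andP [jl ul]; rewrite mem_cat => /orP [] /mapP [q ql ->] /=.
  exact: IH.
rewrite (IH _ ul ql) andbT; apply: contra jl => jq.
by apply: (splits_sub ql); rewrite jq orbT.
Qed.

(** Double counting: splitting and then removing [j] from the second part amounts to removing [j]
    first and then splitting the rest. *)
Lemma big_splits_rem l (F : T -> seq T -> seq T -> V) : uniq l ->
  \sum_(p <- splits l) \sum_(j <- p.2) F j p.1 (rem j p.2) =
  \sum_(j <- l) \sum_(p <- splits (rem j l)) F j p.1 p.2.
Proof.
elim: l F => [|k l IH] F; first by rewrite /= big_seq1 !big_nil.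
move=> /= /andP [kl ul]; rewrite big_splits_cons big_cons eqxx big_split /=.
rewrite (IH (fun j A C => F j (k :: A) C)) //.
have -> : \sum_(p <- splits l) \sum_(j <- k :: p.2) F j p.1 (rem j (k :: p.2)) =
  \sum_(p <- splits l) F k p.1 p.2 +
  \sum_(p <- splits l) \sum_(j <- p.2) F j p.1 (k :: rem j p.2).
  rewrite -big_split; apply: eq_big_seq => p pl; rewrite big_cons /= eqxx.
  congr (_ + _); apply: eq_big_seq => j jp; case: eqP => // kj.
  by rewrite kj (splits_sub pl) // jp orbT in kl.
rewrite (IH (fun j A C => F j A (k :: C))) // addrCA; congr (_ + _).
rewrite -big_split; apply: eq_big_seq => j jl /=.
have -> : (k == j) = false by apply/eqP => kj; rewrite kj jl in kl.
by rewrite big_splits_cons big_split.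
Qed.

(** Exactly one split has the elements satisfying [q] as its second part. With [q] the points moved
    by a permutation, each permutation meets one split. *)
Lemma big_splits_filter l (q : pred T) (F : seq T -> seq T -> V) : uniq l ->
  \sum_(p <- splits l) (if all (fun i => (i \in p.2) == q i) l then F p.1 p.2 else 0) =
  F [seq j <- l | ~~ q j] [seq j <- l | q j].
Proof.
elim: l F => [|i l IH] F; first by rewrite /= big_seq1.
move=> /= /andP [il ul]; rewrite big_splits_cons /=.
pose G A C := if q i then F A (i :: C) else F (i :: A) C.
have -> : F (if ~~ q i then i :: [seq j <- l | ~~ q j] else [seq j <- l | ~~ q j])
   (if q i then i :: [seq j <- l | q j] else [seq j <- l | q j]) = G [seq j <- l | ~~ q j] [seq j <- l | q j].
  by rewrite /G; case: (q i).
rewrite -IH //; apply: eq_big_seq => p pl.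
have ip : i \notin p.2 by apply: contra il => ip; apply: (splits_sub pl); rewrite ip orbT.
rewrite (negPf ip) mem_head /=.
have -> : all (fun j => (j \in i :: p.2) == q j) l = all (fun j => (j \in p.2) == q j) l.
  by apply: eq_in_all => j jl; rewrite inE; case: (eqVneq j i) => // ji; rewrite -ji jl in il.
by rewrite /G; case: (q i); rewrite /= ?add0r ?addr0.
Qed.

End Splittings.

(** * Derangement sums and partial fractions *)

Section Derangements.
Variables (K : fieldType) (m : nat).
Implicit Types (s t : 'S_m) (i j k : 'I_m) (C : seq 'I_m).

Definition displaces C s := [forall i, (s i != i) == (i \in C)].

(* The determinant of the submatrix of b on C when b has zero diagonal. *)
Definition hollow_det (b : 'I_m -> 'I_m -> K) C : K :=
  \sum_(s : 'S_m | displaces C s) (-1) ^+ s * \prod_(i | s i != i) b i (s i).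

Lemma hollow_det_nil b : hollow_det b [::] = 1.
Proof.
rewrite /hollow_det (big_pred1 (1%g : 'S_m)) => [|s].
  by rewrite odd_perm1 mul1r big_pred0 // => i; rewrite perm1 eqxx.
apply/forallP/eqP => [h|-> i]; last by rewrite perm1 eqxx.
apply/permP => i; rewrite perm1; apply/eqP; move: (h i).
by rewrite in_nil eqbF_neg negbK.
Qed.

Variables (a : K) (y : 'I_m -> K).
Hypothesis y_inj : injective y.
Let b i j := a / (y i - y j).

(* Removing i from the cycle through i of a permutation leaves a permutation t
   of C together with the position k of i.  When t moves k, partial fractions
   make the sum over k telescope along the cycles of t, so only the
   transpositions (i k) survive. *)
Lemma hollow_det_cons i C : uniq (i :: C) ->
  hollow_det b (i :: C) = \sum_(k <- C) (a / (y i - y k)) ^+ 2 * hollow_det b (rem k C).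
Proof.
move=> /= /andP [iC uC].
(* The permutation being expanded is [s = tperm i k * t], where [k] is the preimage of [i] under
   [s]. Then [t] fixes [i], and [s] sends [i] to [t k] and [k] to [i]; the transposition accounts
   for the sign in [step1]. *)
pose term t k := (-1) ^+ t * (b i (t k) * b k i * \prod_(l | (l != i) && (l != k) && (t l != l)) b l (t l)).
pose cond t k := [&& k \in C, t i == i & [forall l, (l != i) ==> (l != k) ==> ((t l != l) == (l \in C))]].
have step1 : hollow_det b (i :: C) = - \sum_k \sum_(t | cond t k) term t k.
  rewrite /hollow_det (partition_big (fun s => (s^-1)%g i) xpredT) //= -sumrN.
  apply: eq_bigr => k _; rewrite -sumrN.
  have [ki|ki] := eqVneq k i.
    rewrite !big_pred0 // => t; rewrite /cond ?ki ?(negPf iC) //.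
    apply/negP => /andP [/forallP /(_ i)]; rewrite mem_head eqb_id => si /eqP ik.
    by case/eqP: si; rewrite -{1}ik permKV.
  rewrite (reindex_inj (mulgI (tperm i k))) /=.
  have tE t l : (tperm i k * t)%g l = if l == i then t k else if l == k then t i else t l.
    rewrite permM; case: tpermP => [->|->|/eqP li /eqP lk]; first by rewrite eqxx.
      by rewrite (negPf ki) eqxx.
    by rewrite (negPf li) (negPf lk).
  apply: eq_big => [t|t /andP [/forallP ds sk]].
    have -> : (((tperm i k * t)^-1)%g i == k) = (t i == i).
      rewrite -(inj_eq (@perm_inj _ (tperm i k * t)%g)) permKV tE (negPf ki) eqxx.
      by rewrite eq_sym.
    rewrite /cond; case: eqP => [ti|]; last by rewrite !andbF.
    rewrite andbT /=.
    have tk : t k != i by rewrite -[X in _ != X]ti (inj_eq perm_inj).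
    apply/forallP/andP => [h|[kC /forallP h] l].
      split; first by have := h k; rewrite tE (negPf ki) eqxx ti [i == k]eq_sym ki inE (negPf ki) /= => /eqP.
      apply/forallP => l; apply/implyP => li; apply/implyP => lk.
      by have := h l; rewrite tE (negPf li) (negPf lk) inE (negPf li).
    rewrite tE inE; case: (eqVneq l i) => [->|li] /=; first by rewrite tk.
    case: (eqVneq l k) => [->|lk]; first by rewrite ti [i == k]eq_sym ki kC.
    by have := h l; rewrite li lk.
  have ti : t i = i.
    move/eqP: sk => sk; have := congr1 (tperm i k * t)%g sk.
    by rewrite permKV tE (negPf ki) eqxx.
  have tk : t k != i by rewrite -[X in _ != X]ti (inj_eq perm_inj).
  rewrite odd_permM odd_tperm [i == k]eq_sym ki /term signr_addb expr1 mulN1r mulNr; congr (- (_ * _)).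
  rewrite (bigD1 i) /=; last by rewrite tE eqxx.
  rewrite (bigD1 k) /=; last by rewrite tE (negPf ki) eqxx ti eq_sym ki.
  rewrite !tE eqxx (negPf ki) eqxx ti mulrA; congr (_ * _).
  apply: eq_big => [l|l /andP [/andP [_ li] lk]]; last by rewrite tE (negPf li) (negPf lk).
  rewrite tE; case: (eqVneq l i) => [->|li] /=; first by rewrite andbF.
  by case: (eqVneq l k) => [->|lk] /=; rewrite ?andbF ?andbT.
rewrite step1.
have step2 k : \sum_(t | cond t k) term t k =
  \sum_(t | cond t k && (t k == k)) term t k + \sum_(t | cond t k && (t k != k)) term t k.
  by rewrite (bigID (fun t : 'S_m => t k == k)).
rewrite (eq_bigr _ (fun k _ => step2 k)) big_split /=.
have -> : \sum_k \sum_(t | cond t k && (t k != k)) term t k = 0.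
  pose phi l := (y i - y l)^-1.
  (* When [t] moves [k], it displaces exactly [C], whatever [k] is; so the sum over [k] can be taken
     first. *)
  rewrite (exchange_big_dep (displaces C)) /=; last first.
    move=> k t _ /andP [/and3P [kC ti /forallP h] tk]; apply/forallP => l.
    have [->|li] := eqVneq l i; first by rewrite ti (negPf iC).
    have [->|lk] := eqVneq l k; first by rewrite tk kC.
    by have := h l; rewrite li lk.
  rewrite big1 // => t /forallP dt.
  have /eqP ti : t i == i by have := dt i; rewrite (negPf iC) eqbF_neg negbK.
  have condE k : cond t k && (t k != k) = (t k != k).
    rewrite /cond -(eqP (dt k)) ti eqxx /=; case: (t k != k) => //=.
    by rewrite andbT; apply/forallP => l; rewrite dt !implybT.
  rewrite (eq_bigl _ _ condE).
  (* Partial fractions: [b i (t k) * b k i = b k (t k) * a * (phi (t k) - phi k)]. The differences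
     sum to 0 because [t] permutes the indices. *)
  rewrite (eq_bigr (fun k => ((-1) ^+ t * (\prod_(l | t l != l) b l (t l)) * a) *
     (phi (t k) - phi k))) => [|k tk].
    rewrite -mulr_sumr; set S := \sum_(k | _) _.
    have -> : S = \sum_k (phi (t k) - phi k).
      rewrite /S big_mkcond; apply: eq_bigr => k _.
      by case: eqP => //= ->; rewrite subrr.
    by rewrite sumrB [X in _ - X](reindex_inj (@perm_inj _ t)) subrr mulr0.
  have ki : k != i by apply: contra_neq tk => ->.
  have tki : t k != i by rewrite -[X in _ != X]ti (inj_eq perm_inj).
  rewrite /term [in RHS](bigD1 k) //= -!mulrA; congr (_ * _).
  set p := \prod_(l | _) _; set q := \prod_(l | _) _.
  have -> : q = p.
    apply: eq_bigl => l; case: (eqVneq l i) => [->|li] /=; first by rewrite ti eqxx.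
    by rewrite andbC.
  have n1 : y i - y (t k) != 0 by rewrite subr_eq0 (inj_eq y_inj) eq_sym.
  have n2 : y k - y i != 0 by rewrite subr_eq0 (inj_eq y_inj).
  have n3 : y k - y (t k) != 0 by rewrite subr_eq0 (inj_eq y_inj) eq_sym.
  have n4 : y i - y k != 0 by rewrite subr_eq0 (inj_eq y_inj) eq_sym.
  by rewrite /b /phi; field; rewrite n1 n2 n3 n4.
(* Here [t] also fixes [k], and [b i k * b k i] is minus a square, which cancels the sign. *)
rewrite addr0 -sumrN (big_uniq _ uC) /= [RHS]big_mkcond /=.
apply: eq_bigr => k _; case: ifPn => kC; last first.
  by rewrite big_pred0 ?oppr0 // => t; rewrite /cond (negPf kC).
rewrite /hollow_det mulr_sumr -sumrN.
have ki : k != i by apply: contraNneq iC => <-.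
apply: eq_big => [t|t /andP [/and3P [_ /eqP ti _] /eqP tk]].
  rewrite /cond kC /=; apply/andP/forallP => [[/andP [/eqP ti /forallP h] /eqP tk] l|h].
    rewrite mem_rem_uniq // inE; case: (eqVneq l k) => [->|lk]; first by rewrite tk eqxx.
    case: (eqVneq l i) => [->|li]; first by rewrite ti eqxx (negPf iC).
    by have := h l; rewrite li lk.
  have tl l : (t l != l) = (l != k) && (l \in C).
    by rewrite (eqP (h l)) mem_rem_uniq.
  have tk : t k == k by have := tl k; rewrite eqxx; case: (t k == k).
  have ti : t i == i by have := tl i; rewrite (negPf iC) andbF; case: (t i == i).
  rewrite ti tk; split=> //; apply/forallP => l; apply/implyP => _; apply/implyP => lk.
  by rewrite tl lk.
rewrite /term tk [RHS]mulrCA -mulrN; congr (_ * _).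
set p := \prod_(l | _) _; set q := \prod_(l | _) _.
have -> : q = p.
  apply: eq_bigl => l; case: (eqVneq l i) => [->|li] /=; first by rewrite ti eqxx.
  by case: (eqVneq l k) => [->|lk] //=; rewrite tk eqxx.
have n2 : y k - y i != 0 by rewrite subr_eq0 (inj_eq y_inj).
have n4 : y i - y k != 0 by rewrite subr_eq0 (inj_eq y_inj) eq_sym.
by rewrite /b; field; rewrite n2 n4.
Qed.

End Derangements.

(** * The operator determinant *)

Section OperatorDeterminant.
Variables (K : numClosedFieldType) (KA : analytic_field K) (m : nat).
Implicit Types (Y : 'rV[K]_m) (i j k : 'I_m) (l : seq 'I_m) (P f : 'rV[K]_m -> K).

Lemma pderiv_sum (I : eqType) (s : seq I) (Q : pred I) (F : I -> 'rV[K]_m -> K) i Y :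
  (forall p, p \in s -> Q p -> nice (F p)) -> generic Y ->
  pderiv i (fun Y => \sum_(p <- s | Q p) F p Y) Y = \sum_(p <- s | Q p) pderiv i (F p) Y.
Proof.
move=> nF gY; apply: pderiv_hasder.
elim: s nF => [|p s IH] nF.
  rewrite big_nil (_ : (fun z => _) = (fun=> 0)); first exact: hasder_cst.
  by apply/funext => z; rewrite big_nil.
have {}IH := IH (fun q qs => nF q (@mem_behead _ (p :: s) q qs)).
have [Qp|Qp] := boolP (Q p); last first.
  rewrite big_cons (negPf Qp) (_ : (fun z => _) =
    (fun z => \sum_(p <- s | Q p) F p (set_coord i z Y))); first exact: IH.
  by apply/funext => z; rewrite big_cons (negPf Qp).
rewrite big_cons Qp (_ : (fun z => _) =
  (fun z => F p (set_coord i z Y) + \sum_(p <- s | Q p) F p (set_coord i z Y))).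
  apply: (hasderD _ IH); apply: nice_hasder => //; apply: nF => //; exact: mem_head.
by apply/funext => z; rewrite big_cons Qp.
Qed.

(** The logarithmic derivative of [vdm Y ^- 2] in the i-th coordinate. *)
Definition velocity Y i : K := - \sum_(k | k != i) 2 / (Y 0 i - Y 0 k).

Lemma nice_velocity i : nice (fun Y => velocity Y i).
Proof.
apply: (@nice_eq _ _ _ (fun Y => \sum_(k | k != i) (- 2) * (Y 0 i - Y 0 k)^-1)).
  by move=> Y _; rewrite /velocity -sumrN; apply: eq_bigr => k _; rewrite mulNr.
apply: nice_sum => k ki; apply: niceM; first exact: nice_cst.
by apply: nice_inv; rewrite eq_sym.
Qed.

(** Only the term [k = i] depends on [Y_i]. This is the source of [-g_ij] in the recursion. *)
Lemma pderiv_velocity i j Y : generic Y -> j != i ->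
  pderiv i (fun Y => velocity Y j) Y = - (2 / (Y 0 i - Y 0 j) ^+ 2).
Proof.
move=> gY ji; have ni k : k != j -> nice (fun Y => (Y 0 j - Y 0 k)^-1).
  by move=> kj; apply: nice_inv; rewrite eq_sym.
have nt k : k != j -> nice (fun Y => (- 2) * (Y 0 j - Y 0 k)^-1).
  by move=> kj; apply: niceM; [exact: nice_cst | exact: ni].
rewrite (_ : (fun Y => _) = (fun Y => \sum_(k | k != j) (- 2) * (Y 0 j - Y 0 k)^-1)).
  rewrite pderiv_sum // => [|k _]; last exact: nt.
  have ij : i != j by rewrite eq_sym.
  rewrite (bigD1 i) //= big1 ?addr0 => [|k /andP [kj ki]].
    rewrite (pderivZ KA i (- 2) (ni i ij) gY) pderiv_inv // eqxx (negPf ji) subr0 mul1r.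
    by rewrite -[(Y 0 j - _) ^+ 2]sqrrN opprB mulNr.
  have jk : j != k by rewrite eq_sym.
  by rewrite (pderivZ KA i (- 2) (ni k kj) gY) pderiv_inv // (negPf ki) (negPf ji) subr0 mul0r mulr0.
by apply/funext => Z; rewrite /velocity -sumrN; apply: eq_bigr => k _; rewrite mulNr.
Qed.

Variable c : 'I_m -> K.

Definition full_drift Y i : K := c i + velocity Y i.

Lemma nice_full_drift i : nice (fun Y => full_drift Y i).
Proof. by apply: niceD; [exact: nice_cst | exact: nice_velocity]. Qed.

Lemma pderiv_full_drift i j Y : generic Y -> j != i ->
  pderiv i (fun Y => full_drift Y j) Y = - (2 / (Y 0 i - Y 0 j) ^+ 2).
Proof.
move=> gY ji; rewrite pderivD ?pderiv_cst ?add0r ?pderiv_velocity //.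
  exact: nice_cst.
exact: nice_velocity.
Qed.

(* The derivatives act on P only, not on the coefficients full_drift. *)
Definition normal_ordered l P : 'rV[K]_m -> K := fun Y => frozen (full_drift Y) l P Y.

Lemma normal_ordered_cons i l P Y : nice P -> generic Y ->
  normal_ordered (i :: l) P Y =
    full_drift Y i * normal_ordered l P Y + normal_ordered l (pderiv i P) Y.
Proof. exact: frozen_cons. Qed.

Lemma normal_ordered_eq l P P' Y : nice P' -> (forall Y, generic Y -> P Y = P' Y) ->
  generic Y -> normal_ordered l P Y = normal_ordered l P' Y.
Proof. exact: frozen_eq. Qed.

Lemma nice_normal_ordered l P : nice P -> nice (normal_ordered l P).
Proof.
elim: l P => [//|i l IH] P nP.
apply: nice_eq (niceD (niceM (nice_full_drift i) (IH P nP)) (IH _ (nice_pderiv KA i nP))).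
by move=> Y gY; exact: normal_ordered_cons.
Qed.

Lemma normal_ordered_nil P Y : normal_ordered [::] P Y = P Y.
Proof. by []. Qed.

Opaque normal_ordered.

(** Moving [d_i] inwards past the coefficient of [j] costs [-g_ij] and deletes [j] from the list. *)
Lemma pderiv_normal_ordered i l P Y : i \notin l -> uniq l -> nice P -> generic Y ->
  pderiv i (normal_ordered l P) Y = normal_ordered l (pderiv i P) Y -
    \sum_(j <- l) 2 / (Y 0 i - Y 0 j) ^+ 2 * normal_ordered (rem j l) P Y.
Proof.
move=> + + + gY; elim: l P => [|j l IH] P /=.
  move=> _ _ nP; rewrite big_nil subr0 normal_ordered_nil.
  by apply: (pderiv_eq KA i nP) => // Z _; exact: normal_ordered_nil.
rewrite inE negb_or => /andP [ij il] /andP [jl ul] nP.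
have nw := nice_full_drift j; have nN := nice_normal_ordered l nP.
have nPj := nice_pderiv KA j nP; have nPi := nice_pderiv KA i nP.
have nNj := nice_normal_ordered l nPj.
apply: etrans (pderiv_eq KA i (niceD (niceM nw nN) nNj) _ gY) _.
  by move=> Z gZ; exact: normal_ordered_cons.
rewrite (pderivD KA i (niceM nw nN) nNj gY) (pderivM KA i nw nN gY).
rewrite pderiv_full_drift 1?eq_sym // !IH //.
rewrite normal_ordered_cons // big_cons eqxx.
have swap : normal_ordered l (pderiv j (pderiv i P)) Y =
    normal_ordered l (pderiv i (pderiv j P)) Y.
  apply: (@normal_ordered_eq l _ _ Y (nice_pderiv KA i nPj) _ gY) => Z gZ.
  exact: (pderivC KA j i nP gZ).
rewrite swap {swap}.
have -> : \sum_(k <- l) 2 / (Y 0 i - Y 0 k) ^+ 2 *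
    normal_ordered (if j == k then l else j :: rem k l) P Y =
  full_drift Y j * (\sum_(k <- l) 2 / (Y 0 i - Y 0 k) ^+ 2 * normal_ordered (rem k l) P Y) +
  \sum_(k <- l) 2 / (Y 0 i - Y 0 k) ^+ 2 * normal_ordered (rem k l) (pderiv j P) Y.
  rewrite mulr_sumr -big_split; apply: eq_big_seq => k kl /=.
  have -> : (j == k) = false by apply/eqP => jk; rewrite jk kl in jl.
  by rewrite normal_ordered_cons // mulrDr mulrCA.
move: (full_drift Y j) (normal_ordered l P Y) (normal_ordered l (pderiv i P) Y)
  (normal_ordered l (pderiv i (pderiv j P)) Y) (2 / _) (\sum_(k <- l) _) (\sum_(k <- l) _).
by move=> *; ring.
Qed.

(** Here [d_i] acts on everything to its right, the shape shared with [det_expansion_rec]. *)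
Lemma normal_ordered_rec i l P Y : i \notin l -> uniq l -> nice P -> generic Y ->
  normal_ordered (i :: l) P Y =
    full_drift Y i * normal_ordered l P Y + pderiv i (normal_ordered l P) Y +
    \sum_(j <- l) 2 / (Y 0 i - Y 0 j) ^+ 2 * normal_ordered (rem j l) P Y.
Proof.
move=> il ul nP gY; rewrite pderiv_normal_ordered // normal_ordered_cons //.
by rewrite -!addrA addNr addr0.
Qed.

(** The conjugate of [c i + d_i] by [vdm Y ^+ 2]. In contrast with [normal_ordered], its derivative
    also acts on the coefficients to its right. *)
Definition covariant i : oper K m := fun f Y => full_drift Y i * f Y + pderiv i f Y.

Definition covariants l P := foldr covariant P l.

Lemma nice_covariants l P : nice P -> nice (covariants l P).
Proof.
move=> nP; elim: l => [//|i l IH]; apply: niceD; last exact: nice_pderiv.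
by apply: niceM => //; exact: nice_full_drift.
Qed.

Definition coupling Y i j : K := sqrtC 2 / (Y 0 i - Y 0 j).

Lemma nice_coupling i j : i != j -> nice (fun Y => coupling Y i j).
Proof. by move=> ij; apply: niceM; [exact: nice_cst | exact: nice_inv]. Qed.

Lemma nice_hollow_det C : nice (fun Y => hollow_det (coupling Y) C).
Proof.
apply: nice_sum => s _; apply: niceM; first exact: nice_cst.
by apply: nice_prod => i si; apply: nice_coupling; rewrite eq_sym.
Qed.

(** A permutation maps its displaced points to displaced points, so only coordinates with index in
    [C] occur. *)
Lemma hollow_det_indep i C z Y : i \notin C ->
  hollow_det (coupling (set_coord i z Y)) C = hollow_det (coupling Y) C.
Proof.
move=> iC; apply: eq_bigr => s /forallP ds; congr (_ * _); apply: eq_bigr => j sj.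
have sE k : s k != k -> k == i = false.
  by move=> sk; apply: contraNF iC => /eqP <-; rewrite -(eqP (ds k)).
by rewrite /coupling !set_coordE !sE // (inj_eq perm_inj).
Qed.

(** The expansion over permutations, grouped by the set [p.2] of displaced points. *)
Definition det_expansion l P : 'rV[K]_m -> K := fun Y =>
  \sum_(p <- splits l) hollow_det (coupling Y) p.2 * covariants p.1 P Y.

(** If [i] is fixed, its operator passes through [hollow_det], which does not depend on [Y_i]. If
    [i] is displaced, [hollow_det_cons] applies, the square of [sqrtC 2] giving [g_ij]. *)
Lemma det_expansion_rec i l P Y : i \notin l -> uniq l -> nice P -> generic Y ->
  det_expansion (i :: l) P Y =
    full_drift Y i * det_expansion l P Y + pderiv i (det_expansion l P) Y +
    \sum_(j <- l) 2 / (Y 0 i - Y 0 j) ^+ 2 * det_expansion (rem j l) P Y.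
Proof.
move=> il ul nP gY; rewrite {1}/det_expansion big_splits_cons big_split /=.
congr (_ + _).
  rewrite pderiv_sum // => [|p _ _]; last first.
    by apply: niceM; [exact: nice_hollow_det | exact: nice_covariants].
  rewrite mulr_sumr -big_split; apply: eq_big_seq => p pl /=.
  have ip : i \notin p.2 by apply: contra il => ip; apply: (splits_sub pl); rewrite ip orbT.
  have nC := nice_covariants p.1 nP.
  rewrite (pderivM KA i (nice_hollow_det p.2) nC gY).
  have -> : pderiv i (fun Y => hollow_det (coupling Y) p.2) Y = 0.
    apply: pderiv_hasder; rewrite (_ : (fun z => _) = (fun=> hollow_det (coupling Y) p.2)).
      exact: hasder_cst.
    by apply/funext => z; exact: hollow_det_indep.
  by rewrite mul0r addr0 /covariant mulrDr mulrCA.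
transitivity (\sum_(p <- splits l) \sum_(j <- p.2)
  2 / (Y 0 i - Y 0 j) ^+ 2 * (hollow_det (coupling Y) (rem j p.2) * covariants p.1 P Y)).
  apply: eq_big_seq => p pl; rewrite hollow_det_cons //=.
    rewrite mulr_suml; apply: eq_bigr => j _.
    by rewrite expr_div_n sqrtCK mulrA.
  rewrite (splits_uniq ul pl) andbT.
  by apply: contra il => ip; apply: (splits_sub pl); rewrite ip orbT.
rewrite (big_splits_rem (fun j A C => 2 / (Y 0 i - Y 0 j) ^+ 2 *
  (hollow_det (coupling Y) C * covariants A P Y))) //.
by apply: eq_bigr => j _; rewrite mulr_sumr.
Qed.

(* Wick's theorem: both sides satisfy the same recursion on l. *)
Lemma det_expansionE l P Y : uniq l -> nice P -> generic Y ->
  det_expansion l P Y = normal_ordered l P Y.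
Proof.
(* The recursion also calls [rem j l], which need not be a tail, so the induction is on the size. *)
move=> + nP; have [n] := ubnP (size l); elim: n l Y => // n IH [|i l] Y /=.
  by move=> _ _ _; rewrite /det_expansion big_seq1 hollow_det_nil mul1r normal_ordered_nil.
rewrite ltnS => ln /andP [il ul] gY.
rewrite det_expansion_rec // normal_ordered_rec // IH //.
rewrite (pderiv_eq KA i (nice_normal_ordered l nP)) => // [|Z gZ]; last exact: IH.
congr (_ + _); apply: eq_big_seq => j jl; rewrite IH ?rem_uniq //.
by apply: leq_trans ln; rewrite size_rem // ltnS leq_pred.
Qed.

End OperatorDeterminant.

(** * Conjugation by the Vandermonde determinant and the two formulas *)

Section DeterminantFormula.
Variables (K : numClosedFieldType) (KA : analytic_field K).

Lemma vdm_neq0 m (Y : 'rV[K]_m) : generic Y -> vdm Y != 0.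
Proof.
move=> gY; apply/prodf_neq0 => i _; apply/prodf_neq0 => j ji.
by rewrite subr_eq0; apply: generic_neq => //; rewrite -(inj_eq val_inj) /= gtn_eqF.
Qed.

Section Fixed.
Variable m : nat.
Implicit Types (Y : 'rV[K]_m) (i j k : 'I_m) (l : seq 'I_m) (P Q f : 'rV[K]_m -> K).

Definition inv_vdm2 (a : K) Y : K := (a * vdm Y ^+ 2)^-1.

Lemma inv_vdm2E a Y : inv_vdm2 a Y =
  a^-1 * \prod_(i < m) \prod_(j < m | (j < i)%N) ((Y 0 i - Y 0 j)^-1 * (Y 0 i - Y 0 j)^-1).
Proof.
rewrite /inv_vdm2 invfM -prodrXl -prodfV; congr (_ * _); apply: eq_bigr => i _.
rewrite -prodrXl -prodfV; apply: eq_bigr => j _.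
by rewrite -exprVn expr2.
Qed.

Lemma nice_inv_vdm2 a : nice (inv_vdm2 a).
Proof.
apply: nice_eq (fun Y _ => inv_vdm2E a Y) _; apply: niceM; first exact: nice_cst.
apply: nice_prod => i _; apply: nice_prod => j ji.
have ij : i != j by rewrite -(inj_eq val_inj) /= gtn_eqF.
by apply: niceM; exact: nice_inv.
Qed.

(** The left side is the logarithmic derivative read off the product over pairs; only pairs
    containing [i] contribute. *)
Lemma velocityE Y i :
  \sum_(p < m) \sum_(q < m | (q < p)%N)
    2 * (((q == i)%:R - (p == i)%:R) / (Y 0 p - Y 0 q)) = velocity Y i.
Proof.
transitivity (\sum_(p < m | (i < p)%N) 2 / (Y 0 p - Y 0 i)
  - \sum_(q < m | (q < i)%N) 2 / (Y 0 i - Y 0 q)).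
  rewrite (eq_bigr (fun p : 'I_m => \sum_(q < m | (q < p)%N) 2 * ((q == i)%:R / (Y 0 p - Y 0 q)) -
     \sum_(q < m | (q < p)%N) 2 * ((p == i)%:R / (Y 0 p - Y 0 q)))) => [|p _]; last first.
    by rewrite -sumrB; apply: eq_bigr => q _; rewrite mulrBl mulrBr.
  rewrite sumrB; congr (_ - _).
    rewrite [RHS]big_mkcond; apply: eq_bigr => p _; case: ifPn => ip.
      rewrite (bigD1 i) //= eqxx mul1r big1 ?addr0 // => q /andP [_ /negPf ->].
      by rewrite mul0r mulr0.
    rewrite big1 // => q qp; case: eqP => [qi|]; last by rewrite mul0r mulr0.
    by rewrite -qi qp in ip.
  rewrite (bigD1 i) //= [X in _ + X]big1 ?addr0 => [|p /negPf pi]; last first.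
    by rewrite big1 // => q _; rewrite pi mul0r mulr0.
  by apply: eq_bigr => q _; rewrite eqxx mul1r.
rewrite /velocity [in RHS](bigID (fun k : 'I_m => (i < k)%N)) /= opprD; congr (_ - _).
  rewrite -sumrN; apply: eq_big => [k|k ik].
    by rewrite -(inj_eq val_inj) /=; case: ltngtP.
  by rewrite -[Y 0 i - _]opprB invrN mulrN opprK.
by apply: eq_bigl => k; rewrite -(inj_eq val_inj) /=; case: ltngtP.
Qed.

Lemma pderiv_inv_vdm2 a i Y : generic Y ->
  pderiv i (inv_vdm2 a) Y = inv_vdm2 a Y * velocity Y i.
Proof.
move=> gY; apply: pderiv_hasder.
rewrite (_ : (fun z => _) = (fun z => a^-1 * \prod_(p < m) \prod_(q < m | (q < p)%N)
   ((set_coord i z Y 0 p - set_coord i z Y 0 q)^-1 *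
    (set_coord i z Y 0 p - set_coord i z Y 0 q)^-1))); last first.
  by apply/funext => z; exact: inv_vdm2E.
have hpq (p q : 'I_m) : (q < p)%N ->
   hasder (fun z => (set_coord i z Y 0 p - set_coord i z Y 0 q)^-1 *
    (set_coord i z Y 0 p - set_coord i z Y 0 q)^-1) (Y 0 i)
    ((set_coord i (Y 0 i) Y 0 p - set_coord i (Y 0 i) Y 0 q)^-1 *
    (set_coord i (Y 0 i) Y 0 p - set_coord i (Y 0 i) Y 0 q)^-1 *
    (2 * (((q == i)%:R - (p == i)%:R) / (Y 0 p - Y 0 q)))).
  move=> qp; have pq : p != q by rewrite -(inj_eq val_inj) /= gtn_eqF.
  have h := hasder_coord_inv KA i gY pq.
  have := hasderM KA h h; rewrite set_coord_id.
  set e := _ + _; set e' := _ * (2 * _); suff -> : e = e' by [].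
  have t0 : Y 0 p - Y 0 q != 0 by rewrite subr_eq0 generic_neq.
  rewrite /e /e'; move: (Y 0 p - Y 0 q) (_%:R - _) t0 => t u t0.
  by field.
have h p (_ : xpredT p) := hasder_logprod KA (index_enum _) (hpq p).
have := hasderM KA (hasder_cst a^-1 (Y 0 i)) (hasder_logprod KA (index_enum _) h).
by rewrite mul0r addr0 velocityE mulrA -inv_vdm2E set_coord_id.
Qed.

(** Differentiating the factor [Q] adds [velocity] to each coefficient, by the product rule. *)
Lemma frozen_conj c l P Q Y : nice P -> nice Q ->
  (forall i Y, generic Y -> pderiv i Q Y = Q Y * velocity Y i) -> generic Y ->
  frozen c l (fun Y => P Y * Q Y) Y = covariants c l P Y * Q Y.
Proof.
move=> nP nQ dQ; elim: l Y => [//|i l IH] Y gY /=.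
have nC := nice_covariants KA c l nP.
rewrite /shifted IH // (pderiv_eq KA i (niceM nC nQ)) // pderivM // dQ //.
by rewrite /covariant /full_drift; ring.
Qed.

Lemma frozen_in c c' l P : {in l, c =1 c'} -> frozen c l P = frozen c' l P.
Proof.
elim: l => [//|i l IH] cc /=; rewrite IH => [|j jl]; last by rewrite cc // inE jl orbT.
by apply/funext => Y; rewrite /shifted cc // mem_head.
Qed.

Section Entries.
Variables (X : 'rV[K]_m) (xn yn : K).

Definition diag_part Y i : K := scalar_part X xn yn Y i i.

Lemma diag_partE Y i : diag_part Y i = X 0 i - xn - 2 / (Y 0 i - yn).
Proof. by rewrite /diag_part !mxE eqxx addr0. Qed.

Lemma scalar_part_off Y i j : i != j -> scalar_part X xn yn Y i j = coupling Y i j.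
Proof.
by move=> ij; rewrite !mxE (negPf ij) mulr0n !subr0 add0r.
Qed.

(** Each index occurs once, and the diagonal coefficient of [j] depends on [Y_j] only. As a
    derivative [d_i] occurs only when [s] fixes [i], the couplings to its right do not involve
    [Y_i]. All coefficients can therefore be frozen at [Y]. *)
Lemma op_entry_prod (s : 'S_m) l f Y : uniq l -> nice f -> generic Y ->
  foldr (fun i => op_entry X xn yn i (s i)) f l Y =
  (\prod_(i <- l | s i != i) coupling Y i (s i)) *
    frozen (diag_part Y) [seq i <- l | s i == i] f Y.
Proof.
move=> + nf; elim: l Y => [|i l IH] Y /=; first by rewrite big_nil mul1r.
move=> /andP [il ul] gY; rewrite {1}/op_entry IH // big_cons.
have [si|si] := eqVneq (s i) i; last first.
  by rewrite /= addr0 scalar_part_off 1?eq_sym // mulrA.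
rewrite si partialE /= /shifted -/(diag_part Y i) mulrDr mulrCA; congr (_ + _).
set B := \prod_(_ <- _ | _) _; set fl := [seq _ <- _ | _].
have nF := nice_frozen KA (diag_part Y) fl nf.
have [d d1 dg] := generic_near i gY.
apply: pderiv_hasder.
apply: (hasder_eq (g := fun z => B * frozen (diag_part Y) fl f (set_coord i z Y)) d1) => [w wd|].
  rewrite IH //; last exact: dg.
  set Z := set_coord i (Y 0 i + w) Y.
  have Zj j : j != i -> Z 0 j = Y 0 j by rewrite set_coordE => /negPf ->.
  have -> : \prod_(j <- l | s j != j) coupling Z j (s j) = B.
    rewrite /B [LHS]big_seq_cond [RHS]big_seq_cond; apply: eq_bigr => j /andP [jl sj].
    have ji : j != i by apply: contraNneq il => <-.
    by rewrite /coupling !Zj // -si (inj_eq perm_inj).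
  rewrite (@frozen_in _ (diag_part Y)) => [|j]; first by [].
  rewrite mem_filter => /andP [_ jl]; rewrite !diag_partE Zj //.
  by apply: contraNneq il => <-.
have := hasderM KA (hasder_cst B (Y 0 i)) (nice_hasder KA i nF gY).
by rewrite mul0r addr0.
Qed.

(** Wick's theorem turns the right side into [det_expansion]. Exchanging its two sums, each
    permutation selects the one split into its fixed and displaced points. *)
Lemma op_detE P Q Y : nice P -> nice Q ->
  (forall i Y, generic Y -> pderiv i Q Y = Q Y * velocity Y i) -> generic Y ->
  op_det (op_entry X xn yn) (fun Y => P Y * Q Y) Y =
    frozen (full_drift (diag_part Y) Y) (index_enum 'I_m) P Y * Q Y.
Proof.
move=> nP nQ dQ gY; have u := index_enum_uniq 'I_m.
have -> : frozen (full_drift (diag_part Y) Y) (index_enum 'I_m) P Y =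
    det_expansion (diag_part Y) (index_enum 'I_m) P Y by rewrite det_expansionE.
rewrite /det_expansion.
under eq_bigr do rewrite /hollow_det mulr_suml big_mkcond.
rewrite exchange_big mulr_suml; apply: eq_bigr => s _.
rewrite op_prodE op_entry_prod //; last exact: niceM.
rewrite frozen_conj // !mulrA; congr (_ * _).
set B := (-1) ^+ s * _.
rewrite -(eq_filter (a1 := fun i => ~~ (s i != i))) => [|i]; last by rewrite negbK.
rewrite -(big_splits_filter (fun i => s i != i) (fun A _ => B * covariants (diag_part Y) A P Y)) //.
apply: eq_bigr => p _; congr (if _ then _ else _).
apply/allP/forallP => [h i|h i _]; last by rewrite eq_sym.
by rewrite eq_sym; apply: h; rewrite mem_index_enum.
Qed.

End Entries.
End Fixed.

(** The term of the last point comes from the scalar part of the matrix, the others from the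
    conjugation. *)
Lemma full_drift_front m (x y : 'rV[K]_m.+1) i :
  full_drift (diag_part (front x) (x 0 ord_max) (y 0 ord_max) (front y)) (front y) i =
  drift x y i.
Proof.
rewrite /full_drift diag_partE /velocity /drift -!addrA; congr (_ + (_ + _)).
rewrite [X in _ = - X]big_mkcond big_ord_recr /= gtn_eqF //= opprD addrC; congr (- _ - _).
rewrite [LHS]big_mkcond; apply: eq_bigr => k _.
by rewrite -(inj_eq val_inj) [y 0 (widen_ord _ _)](_ : _ = front y 0 k) // mxE.
Qed.

(** The squared Vandermonde quotients leave the squares of [x_i - x_n] and [y_i - y_n]; the
    determinant in the denominator removes one power of [x_i - x_n]. *)
Lemma principal_det m (x y : 'rV[K]_m.+1) : (0 < m)%N -> generic x -> generic y ->
  principal x y =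
    vdm x ^+ 2 * vdm y ^+ 2 *
    (op_det (op_entry (front x) (x 0 ord_max) (y 0 ord_max))
       (fun Y => principal (front x) Y / (vdm (front x) ^+ 2 * vdm Y ^+ 2)) (front y)
     / \det (diag_mx (front x) - (x 0 ord_max)%:M)).
Proof.
move=> m0 gx gy; have nP := nice_principal KA (front x).
have gy' := generic_front gy; have gx' := generic_front gx.
rewrite (op_detE _ _ _ nP (nice_inv_vdm2 _ (vdm (front x) ^+ 2))) //; last first.
  by move=> *; exact: pderiv_inv_vdm2.
have -> : full_drift (diag_part (front x) (x 0 ord_max) (y 0 ord_max) (front y)) (front y) =
    drift x y by apply/funext => i; exact: full_drift_front.
rewrite principal_formula //; set F := frozen _ _ _ _.
have -> : \det (diag_mx (front x) - (x 0 ord_max)%:M) = \prod_(i < m) (front x 0 i - x 0 ord_max).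
  have -> : diag_mx (front x) - (x 0 ord_max)%:M = diag_mx (\row_i (front x 0 i - x 0 ord_max)).
    by apply/matrixP => i j; rewrite !mxE mulrnBl.
  by rewrite det_diag; apply: eq_bigr => i _; rewrite mxE.
rewrite !vdm_front /inv_vdm2 [X in X * F = _]big_split /=.
have sq (z : 'rV[K]_m.+1) : (vdm (front z) * \prod_i (z 0 ord_max - front z 0 i)) ^+ 2 =
    vdm (front z) ^+ 2 * \prod_i (front z 0 i - z 0 ord_max) ^+ 2.
  by rewrite exprMn; congr (_ * _); rewrite -prodrXl; apply: eq_bigr => i _; rewrite -sqrrN opprB.
rewrite !sq [\prod_i (front x 0 i - _) ^+ 2]prodrXl.
have d0 : \prod_i (front x 0 i - x 0 ord_max) != 0.
  apply/prodf_neq0 => i _; rewrite subr_eq0 mxE; apply: generic_neq => //.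
  by rewrite -(inj_eq val_inj) /= ltn_eqF.
have v0 := vdm_neq0 gx'; have w0 := vdm_neq0 gy'.
set d := \prod_i (front x 0 i - x 0 ord_max) in d0 *.
set p := \prod_i (front y 0 i - y 0 ord_max) ^+ 2.
by field; rewrite d0 v0 w0.
Qed.

Lemma principal_op_prod m (x y : 'rV[K]_m.+1) : (0 < m)%N -> generic y ->
  principal x y =
    (\prod_(i < m) ((front x 0 i - x 0 ord_max) * (front y 0 i - y 0 ord_max) ^+ 2)) *
    op_prod (fun (i : 'I_m) (f : 'rV[K]_m -> K) (a : 'rV[K]_m) =>
        (front x 0 i - x 0 ord_max
         - \sum_(k < m.+1 | (k != i :> nat)) 2 / (front y 0 i - y 0 k)) * f a
        + partial i f a)
      (principal (front x)) (front y).
Proof.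
move=> m0 gy; rewrite principal_formula //; last exact: nice_principal.
by rewrite op_prodE partialE.
Qed.

End DeterminantFormula.

Theorem mainTheorem9 (R : realType) (m : nat) (x y : 'rV[R[i]]_m.+1)
    (hn : (2 <= m.+1)%N) (hy : injective (y 0)) :
  let x' : 'rV[R[i]]_m := front x in
  let y' : 'rV[R[i]]_m := front y in
  let xn : R[i] := x 0 ord_max in
  let yn : R[i] := y 0 ord_max in
  principal x y =
    (\prod_(i < m) ((x' 0 i - xn) * (y' 0 i - yn) ^+ 2)) *
    op_prod (fun (i : 'I_m) (f : 'rV[R[i]]_m -> R[i]) (a : 'rV[R[i]]_m) =>
        (x' 0 i - xn
         - \sum_(k < m.+1 | (k != i :> nat)) 2 / (y' 0 i - y 0 k)) * f a
        + partial i f a)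
      (principal x') y'
  /\
  (injective (x 0) ->
   principal x y =
     vdm x ^+ 2 * vdm y ^+ 2 *
     (op_det (op_entry x' xn yn)
        (fun Y => principal x' Y / (vdm x' ^+ 2 * vdm Y ^+ 2)) y'
      / \det (diag_mx x' - xn%:M))).
Proof.
have KA := complex_analytic_field R.
have m0 : (0 < m)%N by [].
split=> [|hx]; first exact: (principal_op_prod KA x m0 hy).
exact: (principal_det KA m0 hx hy).
Qed.
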